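(* Let $N\geq 0$ be an integer and let $\Gamma \leq \mathrm{Diff}_{+}(I)$ be an irreducible subgroup such that every non-identity element of $\Gamma$ has at most $N$ fixed points in $(0,1)$. Then $\Gamma$ is isomorphic to a subgroup of $\mathrm{Aff}_{+}(\mathbb{R})$. Moreover, if $\Gamma$ is not Abelian, then $\Gamma$ is conjugate to a subgroup of $\mathrm{Aff}_{+}(\mathbb{R})$.
   Context: $I=[0,1]$; $\mathrm{Diff}_{+}(I)$ is the group of orientation preserving $C^1$ diffeomorphisms of $I$. A subgroup of $\mathrm{Homeo}_+(I)$ is irreducible if it has no global fixed point in $(0,1)$. $\mathrm{Aff}_{+}(\mathbb{R})$ is the group of orientation preserving affine homeomorphisms $x\mapsto ax+b$, $a>0$, of $\mathbb{R}$. Subgroups of $\mathrm{Homeo}_+(I)$ are also viewed as subgroups of $\mathrm{Homeo}_+(\mathbb{R})$ by restricting to $(0,1)$ and identifying $(0,1)$ with $\mathbb{R}$ by an orientation preserving homeomorphism; ''conjugate'' means topologically conjugate (by an orientation preserving homeomorphism) under this identification. *)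

(* Defs.v *)
From HB Require Import structures.
From mathcomp Require Import all_boot all_order all_algebra.
From mathcomp Require Import all_classical all_reals all_analysis.
From mathcomp Require Import lra.

Set Implicit Arguments.
Unset Strict Implicit.
Unset Printing Implicit Defensive.

Import Order.TTheory GRing.Theory Num.Theory.
Import numFieldNormedType.Exports.
Local Open Scope classical_set_scope.
Local Open Scope ring_scope.

(* The groups below consist of bijections R -> R and are represented by their
   sets of elements, under composition. *)
Definition transf_group (T : Type) (G : set (T -> T)) : Prop :=
  [/\ G id,
      forall f g, G f -> G g -> G (f \o g) &
      forall f, G f -> exists g, [/\ G g, cancel f g & cancel g f]].

Definition transf_subgroup (T : Type) (G H : set (T -> T)) : Prop :=
  transf_group G /\ G `<=` H.

Definition transf_abelian (T : Type) (G : set (T -> T)) : Prop :=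
  forall f g, G f -> G g -> f \o g = g \o f.

Definition transf_isom (T U : Type) (G : set (T -> T)) (H : set (U -> U)) :
    Prop :=
  exists phi : (T -> T) -> (U -> U),
    set_bij G H phi /\
    forall f g, G f -> G g -> phi (f \o g) = phi f \o phi g.

(* f and g restrict to mutually inverse orientation preserving homeomorphisms
   A -> B and B -> A; their values outside A and B are irrelevant. *)
Definition ohomeo (R : realType) (A B : set R) (f g : R -> R) : Prop :=
  [/\ (forall x, A x -> B (f x)) /\ (forall y, B y -> A (g y)),
      (forall x, A x -> g (f x) = x) /\ (forall y, B y -> f (g y) = y),
      {within A, continuous f} /\ {within B, continuous g} &
      forall x y, A x -> A y -> x < y -> f x < f y].

(* The difference quotients are taken inside [0, 1], so the derivative is
   one-sided at the endpoints. *)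
Definition C1_unit (R : realType) (f : R -> R) : Prop :=
  exists df : R -> R,
    {within `[0, 1], continuous df} /\
    forall x : R, `[0, 1]%classic x ->
      (f y - f x) / (y - x) @[y --> within `[0, 1] x^'] --> df x.

(* A diffeomorphism of [0, 1] is represented by its extension to R by the
   identity, so that equality of functions is equality of diffeomorphisms. *)
Definition Diff_plus (R : realType) : set (R -> R) :=
  [set f | (forall x : R, ~ `[0, 1]%classic x -> f x = x) /\
     exists g, [/\ ohomeo `[0, 1] `[0, 1] f g, C1_unit f & C1_unit g]].

Definition irreducible (R : realType) (G : set (R -> R)) : Prop :=
  ~ exists x : R, `]0, 1[%classic x /\ forall f, G f -> f x = x.

Definition fixed_points (R : realType) (f : R -> R) : set R :=
  [set x | `]0, 1[%classic x /\ f x = x].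

Definition Aff_plus (R : realType) : set (R -> R) :=
  [set f | exists a b, 0 < a /\ f = fun x => a * x + b].

Definition conj_set (R : realType) (h k : R -> R) (G : set (R -> R)) :
    set (R -> R) :=
  [set h \o f \o k | f in G].

Definition conjugate (R : realType) (G H : set (R -> R)) : Prop :=
  exists psi psi', ohomeo setT setT psi psi' /\ conj_set psi psi' G = H.

(* theta is an identification of (0, 1) with R, with inverse theta'; then
   conj_set theta theta' transports a group acting on (0, 1) to R. *)
Definition identification (R : realType) (theta theta' : R -> R) : Prop :=
  ohomeo `]0, 1[ setT theta theta'.

Lemma identification_exists (R : realType) :
  exists theta theta' : R -> R, identification theta theta'.
Proof.
exists (fun x => ln (x / (1 - x))), (fun y => (1 + expR (- y))^-1).
have pos (x : R) : `]0, 1[%classic x -> 0 < x /\ 0 < 1 - x.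
  by rewrite /= in_itv /= subr_gt0 => /andP[].
have e1 (y : R) : 0 < 1 + expR (- y) by rewrite addr_gt0 ?expR_gt0.
split.
- split=> // y _; rewrite /= in_itv /= invr_gt0 e1 /=.
  by rewrite invf_lt1 // ltrDl expR_gt0.
- split=> [x /pos[x0 x1]|y _].
    rewrite expRN lnK ?posrE ?divr_gt0 //.
    rewrite invf_div -[X in X + _](divff (lt0r_neq0 x0)) -mulrDl addrCA subrr.
    by rewrite addr0 mul1r invrK.
  have ey := expR_gt0 (- y).
  have -> : (1 + expR (- y))^-1 / (1 - (1 + expR (- y))^-1) = expR y.
    have -> : 1 - (1 + expR (- y))^-1 = expR (- y) / (1 + expR (- y)).
      by rewrite -[X in X - _](divff (lt0r_neq0 (e1 y))) -[X in _ - X]mul1r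
        -mulrBl addrAC subrr add0r.
    by rewrite invf_div mulrA mulVf ?lt0r_neq0 // mul1r expRN invrK.
  exact: expRK.
- split.
    apply: continuous_in_subspaceT => x /set_mem/pos[x0 x1].
    apply: continuous_comp; last by apply: continuous_ln; rewrite divr_gt0.
    apply: cvgM; first exact: cvg_id.
    apply: cvgV; first by rewrite lt0r_neq0.
    by apply: cvgB; [exact: cvg_cst | exact: cvg_id].
  apply: continuous_subspaceT => y.
  apply: cvgV; first by rewrite lt0r_neq0.
  apply: cvgD; first exact: cvg_cst.
  apply: continuous_comp; last exact: continuous_expR.
  by apply: cvgN; exact: cvg_id.
- move=> x y /pos[x0 x1] /pos[y0 y1] xy.
  rewrite ltr_ln ?posrE ?divr_gt0 //.
  rewrite ltr_pdivrMr // mulrAC ltr_pdivlMr //; nra.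
Qed.

(* Main.v *)
(* The graphs of two distinct elements of Gamma do not cross near 0, so comparing
   germs at 0 is a total bi-invariant order on Gamma.  If the action on (0, 1) is
   free, this order is archimedean and Hoelder's theorem embeds Gamma into the
   translations.

   In general, a descending chain of N + 2 archimedean classes would produce an
   element whose graph crosses the diagonal N + 1 times (compose large powers,
   from the smallest class to the largest).  Hence there is a smallest class; with
   id it generates a normal archimedean subgroup A, abelian by Hoelder's theorem
   and then free by irreducibility.  Conjugation rescales the homomorphism
   tau : A -> R, so Psi x = sup {tau a | a (1/2) <= x} semiconjugates Gamma to an
   affine action.  An element with a fixed point rescales tau by a factor other
   than 1, so tau (A) is dense and Psi is onto.

   The C^1 hypothesis is used only near 0, to show that Psi is injective. *)

Require Import Defs.
From HB Require Import structures.
From mathcomp Require Import all_boot all_order all_algebra.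
From mathcomp Require Import all_classical all_reals all_analysis.
From mathcomp Require Import ring lra zify.

Set Implicit Arguments.
Unset Strict Implicit.
Unset Printing Implicit Defensive.

Import Order.TTheory GRing.Theory Num.Theory.
Import numFieldNormedType.Exports.
Local Open Scope classical_set_scope.
Local Open Scope ring_scope.

(** * Germs at 0 *)

(** A free group embeds into the translations, so it is abelian and the second claim is vacuous for
    it. A chart on (0, 1) is therefore built only when some non-identity element has a fixed point,
    and that chart then yields both claims.

    Conjugation by g rescales [tau] because the homomorphism in Hoelder's theorem is unique up to a
    factor; the factor of g is the slope of the affine map that g becomes.

    The obstacle is injectivity. Blowing up a free orbit of a countable non-abelian affine group
    gives an action by homeomorphisms in which every non-identity element still has at most one
    fixed point, yet the chart collapses intervals. What excludes this for diffeomorphisms is that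
    conjugate elements have the same derivative at 0. *)

Definition interval_group (R : realType) (G : set (R -> R)) : Prop :=
  [/\ transf_group G,
      forall f, G f -> {homo f : x y / x < y},
      forall f, G f -> continuous f,
      forall f, G f -> forall x : R, ~ (0 < x < 1) -> f x = x &
      forall f, G f -> f <> id -> \forall x \near 0^'+, f x <> x].

Definition cinv (R : realType) (f : R -> R) : R -> R :=
  xget (id : R -> R) [set g | cancel f g /\ cancel g f].

Definition germ_lt (R : realType) (f g : R -> R) : Prop :=
  \forall x \near 0^'+, f x < g x.

(** Equality is that of functions, not of germs: by [germ_total] two distinct elements of the group
    are strictly comparable near 0. *)
Definition germ_le (R : realType) (f g : R -> R) : Prop :=
  f = g \/ germ_lt f g.

Lemma iter_comp (T : Type) n m (f : T -> T) :
  iter (n + m) f = iter n f \o iter m f.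
Proof. by apply/funext => x; rewrite iterD. Qed.

Lemma iterSf (T : Type) n (f : T -> T) : iter n.+1 f = f \o iter n f.
Proof. by []. Qed.

Lemma iterSfr (T : Type) n (f : T -> T) : iter n.+1 f = iter n f \o f.
Proof. by apply/funext => x; rewrite iterSr. Qed.

Lemma iter_mul (T : Type) n m (f : T -> T) :
  iter (n * m) f = iter n (iter m f).
Proof. by apply/funext => x; rewrite iterM. Qed.

Lemma iter_idf (T : Type) n : iter n (@id T) = id.
Proof. by elim: n => // n IH; rewrite iterSf IH. Qed.

Lemma fixed_between (R : realType) (f : R -> R) a b : continuous f -> a < b ->
  (a < f a /\ f b < b) \/ (f a < a /\ b < f b) ->
  exists2 c, a < c < b & f c = c.
Proof.
move=> cf ab H.
have cg : continuous (fun x => f x - x).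
  by move=> x; apply: cvgB; [exact: cf|exact: cvg_id].
have [|c + c0] := @IVT R (fun x => f x - x) a b 0 (ltW ab)
    (continuous_subspaceT cg).
  by rewrite /= ge_min le_max; case: H => -[? ?];
    apply/andP; split; apply/orP; [right|left|left|right]; lra.
rewrite in_itv/= => /andP[ac cb]; exists c; last by lra.
have ca : c != a by apply/eqP => E; rewrite E in c0; lra.
have bc : b != c by apply/eqP => E; rewrite -E in c0; lra.
by rewrite !lt_neqAle ac cb eq_sym ca eq_sym bc.
Qed.

Section Group.
Variables (R : realType) (G : set (R -> R)).
Hypothesis HG : interval_group G.
Implicit Types (f g h : R -> R) (x y : R).

Lemma group_id : G id. Proof. by case: HG => -[]. Qed.

Lemma group_comp f g : G f -> G g -> G (f \o g).
Proof. by case: HG => -[_ + _ _ _ _ _]; apply. Qed.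

Lemma cinvP f : G f -> [/\ G (cinv f), cancel f (cinv f) & cancel (cinv f) f].
Proof.
case: HG => -[_ _ Hinv _ _ _ _] /Hinv[g [Gg fg gf]].
have [E1 E2] : cancel f (cinv f) /\ cancel (cinv f) f.
  exact: (@xgetPex (R -> R) id (fun g => cancel f g /\ cancel g f)
    (ex_intro _ g (conj fg gf))).
suff -> : cinv f = g by split.
by apply/funext => y; rewrite -{1}[y]gf E1.
Qed.

Lemma cinvK f : G f -> cinv f \o f = id.
Proof. by move=> /cinvP[_ c _]; apply/funext. Qed.

Lemma cinvVK f : G f -> f \o cinv f = id.
Proof. by move=> /cinvP[_ _ c]; apply/funext. Qed.

Lemma group_inv f : G f -> G (cinv f). Proof. by case/cinvP. Qed.

Lemma group_iter n f : G f -> G (iter n f).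
Proof.
move=> Gf; elim: n => [|n IH]; first exact: group_id.
by rewrite iterSf; exact: group_comp.
Qed.

Lemma iter_inv n f : G f -> iter n (cinv f) \o iter n f = id.
Proof.
move=> Gf; elim: n => // n IH.
rewrite iterSfr iterSf -[LHS]/(iter n (cinv f) \o (cinv f \o f) \o iter n f).
by rewrite cinvK.
Qed.

Lemma group_lt f x y : G f -> (f x < f y) = (x < y).
Proof.
case: HG => _ H _ _ _ /H{}H; apply/idP/idP; last exact: H.
by rewrite !ltNge; apply: contra; rewrite le_eqVlt => /predU1P[->//|/H/ltW].
Qed.

Lemma group_le f x y : G f -> (f x <= f y) = (x <= y).
Proof. by move=> Gf; rewrite !leNgt group_lt. Qed.

Lemma group_cont f : G f -> continuous f.
Proof. by case: HG => _ _ H _ _ /H. Qed.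

Lemma group_out f x : G f -> ~ (0 < x < 1) -> f x = x.
Proof. by case: HG => _ _ _ H _ /H; apply. Qed.

Lemma group0 f : G f -> f 0 = 0.
Proof. by move=> Gf; apply: group_out => //; rewrite ltxx. Qed.

Lemma group1 f : G f -> f 1 = 1.
Proof. by move=> Gf; apply: group_out => //; rewrite ltxx andbF. Qed.

Lemma group_gt0 f x : G f -> (0 < f x) = (0 < x).
Proof. by move=> Gf; rewrite -{1}(group0 Gf) group_lt. Qed.

Lemma group_lt1 f x : G f -> (f x < 1) = (x < 1).
Proof. by move=> Gf; rewrite -{1}(group1 Gf) group_lt. Qed.

(** Since f fixes 0 and preserves the positive side, it permutes germs at 0 from the right. Hence
    right invariance of the order; left invariance is just monotonicity. *)
Lemma near_group f (P : set R) : G f ->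
  (\forall x \near 0^'+, P x) -> \forall x \near 0^'+, P (f x).
Proof.
move=> Gf; rewrite !near_withinE => PH.
have := group_cont Gf (x := 0).
rewrite /continuous_at (group0 Gf) => /(_ _ PH).
by rewrite nbhs_filterE/=; apply: filterS => x /= + x0; apply; rewrite group_gt0.
Qed.

Lemma germ_ltxx f : ~ germ_lt f f.
Proof.
move=> H; suff: \forall x \near (0:R)^'+, False by exact: filter_not_empty.
by apply: filterS H => x; rewrite ltxx.
Qed.

Lemma germ_lt_trans g f h : germ_lt f g -> germ_lt g h -> germ_lt f h.
Proof. by apply: filterS2 => x; exact: lt_trans. Qed.

Lemma germ_ltl h f g : G h -> germ_lt f g -> germ_lt (h \o f) (h \o g).
Proof. by move=> Gh; apply: filterS => x /=; rewrite group_lt. Qed.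

Lemma germ_ltr h f g : G h -> germ_lt f g -> germ_lt (f \o h) (g \o h).
Proof. by move=> Gh; exact: near_group. Qed.

Lemma germ_ltVl f g : G f -> germ_lt f g -> germ_lt id (cinv f \o g).
Proof. by move=> Gf; rewrite -(cinvK Gf); apply: germ_ltl; exact: group_inv. Qed.

Lemma germ_ltN f : G f -> germ_lt id f -> germ_lt (cinv f) id.
Proof.
move=> Gf H; have := germ_ltl (group_inv Gf) H.
by rewrite cinvK.
Qed.

Lemma germ_ltN' f : G f -> germ_lt f id -> germ_lt id (cinv f).
Proof.
move=> Gf H; have := germ_ltl (group_inv Gf) H.
by rewrite cinvK.
Qed.

Lemma germ_le_lt_trans g f h : germ_le f g -> germ_lt g h -> germ_lt f h.
Proof. by case=> [->//|]; exact: germ_lt_trans. Qed.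

Lemma germ_lt_le_trans g f h : germ_lt f g -> germ_le g h -> germ_lt f h.
Proof. by move=> + []; [move=> + <-|exact: germ_lt_trans]. Qed.

Lemma germ_lexx f : germ_le f f. Proof. by left. Qed.

Lemma germ_ltW f g : germ_lt f g -> germ_le f g. Proof. by right. Qed.

Lemma germ_le_trans g f h : germ_le f g -> germ_le g h -> germ_le f h.
Proof.
by case=> [->//|H /(germ_lt_le_trans H)]; right.
Qed.

Lemma germ_lel h f g : G h -> germ_le f g -> germ_le (h \o f) (h \o g).
Proof. by move=> Gh [->|]; [left|right; exact: germ_ltl]. Qed.

Lemma germ_ler h f g : G h -> germ_le f g -> germ_le (f \o h) (g \o h).
Proof. by move=> Gh [->|]; [left|right; exact: germ_ltr]. Qed.

Lemma no_fixed_sign f a b : G f -> a < b ->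
  (forall x, a < x < b -> f x <> x) ->
  (forall x, a < x < b -> x < f x) \/ (forall x, a < x < b -> f x < x).
Proof.
move=> Gf ab nofix.
have sgn x y : a < x < b -> a < y < b -> f x < x -> y < f y -> False.
  move=> xab yab fx fy; have [xy|yx|xy] := ltgtP x y;
    last by rewrite xy in fx; lra.
  - have [|c cxy] := fixed_between (group_cont Gf) xy; first by right.
    by apply: nofix; lra.
  - have [|c cxy] := fixed_between (group_cont Gf) yx; first by left.
    by apply: nofix; lra.
have mid : a < (a + b) / 2 < b by lra.
have [H|H|/(nofix _ mid)//] := ltgtP (f ((a + b) / 2)) ((a + b) / 2).
- right => x xab; have [//|fx|/(nofix _ xab)//] := ltgtP (f x) x.
  by case: (sgn _ _ mid xab H fx).
- left => x xab; have [fx|//|/(nofix _ xab)//] := ltgtP (f x) x.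
  by case: (sgn _ _ xab mid fx H).
Qed.

Lemma germ_total1 f : G f -> f <> id -> germ_lt id f \/ germ_lt f id.
Proof.
move=> Gf fid; have [_ _ _ _ /(_ _ Gf fid)] := HG.
move=> /nbhs_right0P; rewrite near_withinE.
move=> /nbhs_ballP[d /= d0 dH].
have nofix x : 0 < x < d -> f x <> x.
  move=> /andP[x0 xd]; have := dH x; rewrite add0r; apply => //=.
  by rewrite /ball/= sub0r normrN gtr0_norm.
have nearH : \forall x \near (0:R)^'+, 0 < x < d.
  near=> x; apply/andP; split; near: x.
    exact: nbhs_right_gt.
  exact: nbhs_right_lt.
by have [H|H] := no_fixed_sign Gf d0 nofix; [left|right]; apply: filterS nearH.
Unshelve. all: by end_near. Qed.

Lemma germ_total f g : G f -> G g -> [\/ f = g, germ_lt f g | germ_lt g f].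
Proof.
move=> Gf Gg; have [/(congr1 (fun h => f \o h))|H] := EM (cinv f \o g = id).
  rewrite -[f \o (_ \o g)]/((f \o cinv f) \o g) cinvVK// => E.
  by constructor 1; rewrite -[RHS]/(id \o g) E.
have := germ_total1 (group_comp (group_inv Gf) Gg) H.
have E : f \o (cinv f \o g) = g.
  by rewrite -[LHS]/((f \o cinv f) \o g) cinvVK.
by case=> /(germ_ltl Gf); rewrite E; [constructor 2|constructor 3].
Qed.

Lemma germ_leNgt f g : G f -> G g -> ~ germ_lt f g -> germ_le g f.
Proof. by move=> Gf Gg; case: (germ_total Gf Gg) => // [->|]; [left|right]. Qed.

Lemma germ_le_iter n f g : G f -> G g -> germ_le f g ->
  germ_le (iter n f) (iter n g).
Proof.
move=> Gf Gg fg; elim: n => [|n IH]; first exact: germ_lexx.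
rewrite !iterSf; apply: (@germ_le_trans (f \o iter n g)).
  exact: germ_lel.
by apply: germ_ler => //; exact: group_iter.
Qed.

Lemma germ_lt_iter n f g : G f -> G g -> germ_lt f g ->
  germ_lt (iter n.+1 f) (iter n.+1 g).
Proof.
move=> Gf Gg fg; rewrite !iterSf; apply: (@germ_le_lt_trans (f \o iter n g)).
  by apply: germ_lel => //; apply: germ_le_iter => //; right.
by apply: germ_ltr => //; exact: group_iter.
Qed.

End Group.

(** * Hoelder's theorem *)

Definition iterz (R : realType) (f : R -> R) (z : int) : R -> R :=
  match z with Posz n => iter n f | Negz n => iter n.+1 (cinv f) end.

Definition archimedean_germs (R : realType) (G : set (R -> R)) : Prop :=
  forall f g, G f -> G g -> germ_lt id f -> exists n, germ_lt g (iter n f).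

Section IntegerPowers.
Variables (R : realType) (G : set (R -> R)).
Hypothesis HG : interval_group G.
Implicit Types (f g h t : R -> R) (x y : R) (z : int).

Lemma group_iterz f z : G f -> G (iterz f z).
Proof.
by case: z => n Gf; [|have Gv := group_inv HG Gf]; exact: group_iter.
Qed.

Lemma iterzS f z : G f -> iterz f (z + 1) = f \o iterz f z.
Proof.
move=> Gf; case: z => [n|[|n]].
- by rewrite -[1]/(Posz 1) -PoszD addn1.
- by rewrite -[1]/(Posz 1) /= (cinvVK HG).
- have -> : Negz n.+1 + 1 = Negz n by lia.
  by rewrite /iterz [in RHS]iterSf -[RHS]/((f \o cinv f) \o _) (cinvVK HG).
Qed.

Lemma iterzP f z : G f -> iterz f (z - 1) = cinv f \o iterz f z.
Proof.
move=> Gf; have -> : iterz f z = f \o iterz f (z - 1).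
  by rewrite -iterzS// subrK.
by rewrite -[RHS]/((cinv f \o f) \o _) (cinvK HG).
Qed.

Lemma iterzD f z z' : G f -> iterz f (z + z') = iterz f z \o iterz f z'.
Proof.
move=> Gf; elim/int_rect: z => [|n IH|n IH]; first by rewrite add0r.
- by rewrite intS -addrA addrC iterzS// IH addrC iterzS.
- by rewrite intS opprD -addrA addrC iterzP// IH addrC iterzP.
Qed.

Lemma iterzM f z n : G f -> iterz f (z * n%:Z) = iter n (iterz f z).
Proof.
move=> Gf; elim: n => [|n IH]; first by rewrite mulr0.
by rewrite intS mulrDr mulr1 iterzD// IH.
Qed.

Lemma germ_lt_iterz t z z' : G t -> germ_lt id t -> z < z' ->
  germ_lt (iterz t z) (iterz t z').
Proof.
move=> Gt t1 zz'; have [n ->] : exists n : nat, z' = z + n.+1%:Z.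
  by exists (absz (z' - z)).-1; lia.
rewrite iterzD//; apply: (germ_ltl HG (f := id)); first exact: group_iterz.
have := germ_lt_iter HG n (group_id HG) Gt t1.
by rewrite iter_idf.
Qed.

Lemma germ_le_iterz t z z' : G t -> germ_lt id t ->
  germ_le (iterz t z) (iterz t z') -> z <= z'.
Proof.
move=> Gt t1 H; rewrite leNgt; apply/negP => /(germ_lt_iterz Gt t1).
by move=> /(germ_le_lt_trans H); exact: germ_ltxx.
Qed.

Lemma germ_floor t f : archimedean_germs G -> G t -> germ_lt id t -> G f ->
  exists z, germ_le (iterz t z) f /\ germ_le f (iterz t (z + 1)).
Proof.
move=> arch Gt t1 Gf.
have [n fn] := arch _ _ Gt Gf t1.
have [m fm] := arch _ _ Gt (group_inv HG Gf) t1.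
have le0 : germ_lt (iterz t (- m%:Z)) f.
  have := germ_ltl HG (group_iterz (- m%:Z) Gt) (germ_ltr HG Gf fm).
  rewrite (cinvK HG)// => /germ_lt_le_trans; apply; left.
  by rewrite -[iter m t]/(iterz t m) -[LHS]/((_ \o _) \o f) -iterzD// addNr.
(* The shift by m turns the search for the least exponent into one over [nat]; j = 0 is excluded
   because t^-m < f. *)
pose P j := `[< germ_lt f (iterz t (j%:Z - m%:Z)) >].
have exP : exists j, P j.
  by exists (n + m)%N; apply/asboolP; rewrite PoszD addrK.
case: (ex_minnP exP) => -[|j] /asboolP Pj jmin.
  by have := germ_lt_trans le0 Pj; rewrite sub0r => /germ_ltxx.
exists (j%:Z - m%:Z); split; last first.
  by right; have -> : j%:Z - m%:Z + 1 = j.+1%:Z - m%:Z by lia.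
apply: (germ_leNgt HG) => //; first exact: group_iterz.
by move=> /asboolP /(jmin j); rewrite ltnn.
Qed.

(** Sorting the letters of the word (f g)^k only uses swaps that move in one direction of the order.
    This replaces commutativity, which is not yet known when additivity of [tau] is proved. *)
Lemma germ_iter_comm f g k : G f -> G g -> germ_le (f \o g) (g \o f) ->
  germ_le (iter k f \o iter k g) (iter k (f \o g)) /\
  germ_le (iter k (g \o f)) (iter k g \o iter k f).
Proof.
move=> Gf Gg fg.
have fkg n : germ_le (iter n f \o g) (g \o iter n f).
  elim: n => [|n IH]; first exact: germ_lexx.
  rewrite [in X in germ_le X _]iterSf.
  apply: (@germ_le_trans _ (f \o g \o iter n f)).
    exact: (germ_lel HG Gf IH).
  exact: (germ_ler HG (group_iter HG n Gf) fg).
elim: k => [|k [IH1 IH2]]; first by split; exact: germ_lexx.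
have Gfk := group_iter HG k Gf; have Ggk := group_iter HG k Gg.
split.
- apply: (@germ_le_trans _ (f \o g \o (iter k f \o iter k g))).
    exact: (germ_lel HG Gf (germ_ler HG Ggk (fkg k))).
  by apply: (germ_lel HG) => //; exact: group_comp.
- apply: (@germ_le_trans _ ((iter k g \o iter k f) \o (g \o f))).
    by rewrite iterSfr; apply: (germ_ler HG) => //; exact: group_comp.
  rewrite !iterSfr.
  exact: (germ_lel HG Ggk (germ_ler HG Gf (fkg k))).
Qed.

End IntegerPowers.

Section Hoelder.
Variables (R : realType) (G : set (R -> R)).
Hypothesis HG : interval_group G.
Hypothesis archG : archimedean_germs G.
Variable t : R -> R.
Hypotheses (Gt : G t) (t1 : germ_lt id t).
Implicit Types (f g : R -> R) (z : int).

(** The rational lower cut of f measured in the unit t, so [tau] is normalised by tau t = 1. The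
    exponent [k.+1] keeps denominators nonzero. *)
Let below f : set R := [set r | exists z k,
  r = z%:~R / k.+1%:R /\ germ_le (iterz t z) (iter k.+1 f)].
Let tau f := sup (below f).

Let below_bound f z k : G f -> germ_le (iter k.+1 f) (iterz t z) ->
  ubound (below f) (z%:~R / k.+1%:R).
Proof.
move=> Gf fz _ [z' [k' [-> fz']]].
(* Each comparison is raised to the exponent of the other, so that both involve the same power of f
   and only powers of t remain. *)
have /(germ_le_iterz HG Gt t1) :
    germ_le (iterz t (z' * k.+1%:Z)) (iterz t (z * k'.+1%:Z)).
  rewrite !(iterzM HG)//.
  apply: (@germ_le_trans _ (iter k.+1 (iter k'.+1 f))).
    by apply: (germ_le_iter HG) => //; [exact: group_iterz|exact: group_iter].
  rewrite -iter_mul mulnC iter_mul.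
  by apply: (germ_le_iter HG) => //; [exact: group_iter|exact: group_iterz].
rewrite -(ler_int R) !intrM => H.
by rewrite ler_pdivrMr ?ltr0n// mulrAC ler_pdivlMr ?ltr0n.
Qed.

Let tau_ge f z k : G f -> germ_le (iterz t z) (iter k.+1 f) ->
  z%:~R / k.+1%:R <= tau f.
Proof.
move=> Gf fz; apply: ub_le_sup; last by exists z, k.
have [z' [_ fz']] := germ_floor HG archG Gt t1 (group_iter HG k.+1 Gf).
by exists ((z' + 1)%:~R / k.+1%:R); exact: below_bound.
Qed.

Let tau_le f z k : G f -> germ_le (iter k.+1 f) (iterz t z) ->
  tau f <= z%:~R / k.+1%:R.
Proof.
move=> Gf fz; apply: ge_sup; last exact: below_bound.
have [z' [fz' _]] := germ_floor HG archG Gt t1 Gf.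
by exists (z'%:~R / 1%:R), z', 0%N.
Qed.

Let tauD f g : G f -> G g -> tau (f \o g) = tau f + tau g.
Proof.
move=> Gf Gg; have Gfg := group_comp HG Gf Gg.
(* The floors z1 and z2 of the (k+1)-st powers of f and g confine (f g)^(k+1) between t^(z1+z2) and
   t^(z1+z2+2). The error is thus at most 2 / (k+1) for every k. *)
have key k : `|tau (f \o g) - (tau f + tau g)| * k.+1%:R <= 2.
  have [z1 [f1 f2]] := germ_floor HG archG Gt t1 (group_iter HG k.+1 Gf).
  have [z2 [g1 g2]] := germ_floor HG archG Gt t1 (group_iter HG k.+1 Gg).
  have Gfk := group_iter HG k.+1 Gf; have Ggk := group_iter HG k.+1 Gg.
  have [H1 H2] : germ_le (iterz t (z1 + z2)) (iter k.+1 (f \o g)) /\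
                 germ_le (iter k.+1 (f \o g)) (iterz t (z1 + z2 + 2)).
    have lo : germ_le (iterz t (z1 + z2)) (iter k.+1 f \o iter k.+1 g).
      rewrite (iterzD HG)//.
      apply: (@germ_le_trans _ (iterz t z1 \o iter k.+1 g)).
        by apply: (germ_lel HG) => //; exact: group_iterz.
      exact: (germ_ler HG).
    have lo' : germ_le (iterz t (z1 + z2)) (iter k.+1 g \o iter k.+1 f).
      rewrite addrC (iterzD HG)//.
      apply: (@germ_le_trans _ (iterz t z2 \o iter k.+1 f)).
        by apply: (germ_lel HG) => //; exact: group_iterz.
      exact: (germ_ler HG).
    have hi : germ_le (iter k.+1 f \o iter k.+1 g) (iterz t (z1 + z2 + 2)).
      have -> : z1 + z2 + 2 = (z1 + 1) + (z2 + 1) by lia.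
      rewrite (iterzD HG)//.
      apply: (@germ_le_trans _ (iterz t (z1 + 1) \o iter k.+1 g)).
        exact: (germ_ler HG).
      by apply: (germ_lel HG) => //; exact: group_iterz.
    have hi' : germ_le (iter k.+1 g \o iter k.+1 f) (iterz t (z1 + z2 + 2)).
      have -> : z1 + z2 + 2 = (z2 + 1) + (z1 + 1) by lia.
      rewrite (iterzD HG)//.
      apply: (@germ_le_trans _ (iterz t (z2 + 1) \o iter k.+1 f)).
        exact: (germ_ler HG).
      by apply: (germ_lel HG) => //; exact: group_iterz.
    have Ggf := group_comp HG Gg Gf.
    have [fg|gf] : germ_le (f \o g) (g \o f) \/ germ_le (g \o f) (f \o g).
      by case: (germ_total HG Gfg Ggf) => [->|H|H]; [left; left|left; right|
        right; right].
    - have [A B] := germ_iter_comm HG k.+1 Gf Gg fg.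
      split; first exact: germ_le_trans lo A.
      apply: germ_le_trans hi'; apply: germ_le_trans B.
      exact: (germ_le_iter HG).
    - have [A B] := germ_iter_comm HG k.+1 Gg Gf gf.
      split; last exact: germ_le_trans B hi.
      apply: germ_le_trans lo' _; apply: germ_le_trans A _.
      exact: (germ_le_iter HG).
  have k0 : 0 < k.+1%:R :> R by rewrite ltr0n.
  have := tau_ge Gf f1; have := tau_le Gf f2.
  have := tau_ge Gg g1; have := tau_le Gg g2.
  have := tau_ge Gfg H1; have := tau_le Gfg H2.
  rewrite !ler_pdivrMr// !ler_pdivlMr// !intrD => ? ? ? ? ? ?.
  rewrite -[X in _ * X <= _](gtr0_norm k0) -normrM ler_norml; apply/andP.
  by split; nra.
apply/eqP; rewrite -subr_eq0 -normr_eq0; apply/eqP/le_anti.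
rewrite normr_ge0 andbT leNgt; apply/negP => e0.
set e := `|_| in key e0.
have := key (Num.trunc (2 / e)).
by rewrite leNgt -ltr_pdivrMl// mulrC truncnS_gt.
Qed.

Let tau_gt0 f : G f -> germ_lt id f -> 0 < tau f.
Proof.
move=> Gf f1; have [[|n] H] := archG Gf Gt f1.
  by have := germ_lt_trans t1 H => /germ_ltxx.
have : germ_le (iterz t 1) (iter n.+1 f) by right.
by move=> /(tau_ge Gf); apply: lt_le_trans; rewrite divr_gt0.
Qed.

Lemma hoelder_pos : exists tau : (R -> R) -> R,
  (forall f g, G f -> G g -> tau (f \o g) = tau f + tau g) /\
  (forall f, G f -> germ_lt id f -> 0 < tau f).
Proof. by exists tau. Qed.

End Hoelder.

Lemma hoelder (R : realType) (G : set (R -> R)) :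
  interval_group G -> archimedean_germs G -> exists tau : (R -> R) -> R,
  (forall f g, G f -> G g -> tau (f \o g) = tau f + tau g) /\
  (forall f, G f -> germ_lt id f -> 0 < tau f).
Proof.
move=> HG arch; have [[t [Gt t1]]|no] := EM (exists t, G t /\ germ_lt id t).
  exact: hoelder_pos HG arch t Gt t1.
exists (fun=> 0); split=> [*|f Gf f1]; first by rewrite addr0.
by case: no; exists f.
Qed.

(** * Finiteness of the number of archimedean classes *)

Definition free_action (R : realType) (G : set (R -> R)) : Prop :=
  forall f, G f -> f <> id -> forall x : R, 0 < x < 1 -> f x <> x.

(** A positive representative of the smallest archimedean class: nothing positive is infinitesimal
    against t. *)
Definition germ_minimal (R : realType) (G : set (R -> R)) (t : R -> R) : Prop :=
  [/\ G t, germ_lt id t &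
      forall f, G f -> germ_lt id f -> (forall n, germ_lt (iter n f) t) -> False].

Lemma bounded_uniform (P : nat -> nat -> Prop) (j : nat) :
  (forall i, (i <= j)%N -> exists n, forall m, (n <= m)%N -> P i m) ->
  exists m, forall i, (i <= j)%N -> P i m.
Proof.
move=> H.
suff [n Hn] : exists n, forall i m, (i <= j)%N -> (n <= m)%N -> P i m.
  by exists n => i ij; exact: Hn ij (leqnn n).
elim: j H => [|j IH] H.
  by have [n Hn] := H 0%N isT; exists n => -[|//] m _; exact: Hn.
have [i /leqW ij|n Hn] := IH; first exact: H.
have [n' Hn'] := H j.+1 (leqnn _).
exists (maxn n n') => i m; rewrite geq_max leq_eqVlt => /predU1P[->|].
  by move=> /andP[_]; exact: Hn'.
by rewrite ltnS => ij /andP[nm _]; apply: Hn.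
Qed.

Section Orbits.
Variables (R : realType) (G : set (R -> R)).
Hypothesis HG : interval_group G.
Implicit Types (f g : R -> R) (x y u v : R).

(** A bounded orbit would have a supremum l in [u, v] with l < f l, but an iterate beyond f^-1 l is
    carried past l by one more step. The conclusion covers all large m so that one exponent can
    serve several intervals. *)
Lemma iter_exit f u v : G f -> u <= v ->
  (forall x, u <= x <= v -> x < f x) ->
  exists n, forall m, (n <= m)%N -> v < iter m f u.
Proof.
move=> Gf uv fgt.
have ufu : u < f u by apply: fgt; rewrite lexx.
have mono n m : (n <= m)%N -> iter n f u <= iter m f u.
  move=> /subnK <-; rewrite addnC iterD (group_le HG)//; last exact: group_iter.
  elim: (m - n)%N => [|k IH]; first exact: lexx.
  by rewrite iterS (le_trans (ltW ufu))// (group_le HG).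
have [[n vn]|no] := EM (exists n, v < iter n f u).
  by exists n => m nm; exact: lt_le_trans vn (mono _ _ nm).
exfalso.
have wv n : iter n f u <= v.
  by rewrite leNgt; apply/negP => H; apply: no; exists n.
pose W := range (fun n => iter n f u); pose l := sup W.
have supW : has_sup W.
  by split; [exists u, 0%N|exists v => _ [n _ <-]].
have ul : u <= l by apply: ub_le_sup; [exact: supW.2|exists 0%N].
have lv : l <= v by apply: ge_sup; [exact: supW.1|move=> _ [n _ <-]].
have /fgt lfl : u <= l <= v by rewrite ul.
have [_ _ fK] := cinvP HG Gf.
have : cinv f l < l by rewrite -(group_lt HG _ _ Gf) fK.
case/(sup_gt supW.1) => _ [n _ <-].
rewrite -(group_lt HG _ _ Gf) fK -iterS ltNge => /negP; apply.
by apply: ub_le_sup; [exact: supW.2|exists n.+1].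
Qed.

(** For a free action f^-1 g has no fixed point, so the sign seen near 0 persists on all of (0,
    1). *)
Lemma free_lt f g x : free_action G -> G f -> G g -> germ_lt f g ->
  0 < x < 1 -> f x < g x.
Proof.
move=> free Gf Gg fg x01; have [Gv fK Kf] := cinvP HG Gf.
have Gh := group_comp HG Gv Gg.
have h1 := germ_ltVl HG Gf fg.
have hid : cinv f \o g <> id by move=> E; rewrite E in h1; exact: germ_ltxx h1.
have [H|H] := no_fixed_sign HG Gh ltr01 (free _ Gh hid).
  by have := H _ x01; rewrite -(group_lt HG _ _ Gf) /= Kf.
exfalso; apply: (@germ_ltxx R id); apply: germ_lt_trans h1 _.
near=> y; apply: H; apply/andP; split; near: y.
  exact: nbhs_right_gt.
exact: nbhs_right_lt.
Unshelve. all: by end_near. Qed.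

Lemma free_archimedean : free_action G -> archimedean_germs G.
Proof.
move=> free f g Gf Gg f1; pose x : R := 2^-1.
have x01 : 0 < x < 1 by rewrite /x; lra.
have gx01 : 0 < g x < 1 by rewrite (group_gt0 HG)// (group_lt1 HG).
(* By [free_lt] a comparison at the single point x decides the order; the maximum only provides a
   right end that is not left of x. *)
have [|y yxg|n /(_ _ (leqnn _)) Hn] := @iter_exit f x (Num.max x (g x)) Gf.
- by rewrite le_max lexx.
- apply: (free_lt free (group_id HG) Gf f1).
  case/andP: x01 gx01 yxg => x0 x1 /andP[_ gx1] /andP[/(lt_le_trans x0) ->].
  by move=> /le_lt_trans; apply; rewrite gt_max x1.
exists n; have Gfn := group_iter HG n Gf.
have [E|//|H] := germ_total HG Gg Gfn.
  by move: Hn; rewrite -E gt_max ltxx andbF.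
have := free_lt free Gfn Gg H x01.
by move: Hn; rewrite gt_max => /andP[_ /lt_trans H1] /H1; rewrite ltxx.
Qed.

End Orbits.

Section FiniteRank.
Variables (R : realType) (N : nat) (G : set (R -> R)).
Hypothesis HG : interval_group G.
Hypothesis fixN : forall f, G f -> f <> id -> forall c : nat -> R,
  (forall i, (i <= N)%N -> 0 < c i < 1 /\ f (c i) = c i) ->
  (forall i, (i < N)%N -> c i < c i.+1) -> False.

Section Chain.
Variables (s : nat -> R -> R).
Hypotheses (Gs : forall n, G (s n)) (s1 : forall n, germ_lt id (s n)).
Hypothesis sdec : forall n m, germ_lt (iter m (s n.+1)) (s n).

(** Points numbered 0 to [k] with alternating signs enclose N + 1 fixed points. The largest element
    [B] of the chain bounds the displacement of all the others near 0. *)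
Let k := N.+1.
Let B := s 0.
Let GB r : G (iter r B) := group_iter HG r (Gs 0).

Let s_leB n : germ_le (s n) B.
Proof.
elim: n => [|n]; first exact: germ_lexx.
exact: germ_le_trans (germ_ltW (sdec n 1)).
Qed.

(** The germ inequalities hold pointwise on a common interval (0, a) because only the finitely many
    indices up to [k] are involved. *)
Let region : exists a : R, [/\ 0 < a, a <= 1 &
  forall x n, (n <= k)%N -> 0 < x < a -> x < s n x /\ s n x <= B x].
Proof.
have H n : \forall x \near (0:R)^'+,
    forall l, (l <= n)%N -> x < s l x /\ s l x <= B x.
  elim: n => [|n IH].
    by apply: filterS (s1 0) => x ? [|//] _; rewrite lexx.
  have /(filterI (s1 n.+1)) : \forall x \near (0:R)^'+, s n.+1 x <= B x.
    case: (s_leB n.+1) => [->|]; first by apply: nearW => x; exact: lexx.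
    by apply: filterS => x /ltW.
  apply: filterS2 IH => x Hx [H1 H2] l.
  by rewrite leq_eqVlt ltnS => /predU1P[->//|]; exact: Hx.
have := H k; rewrite near_withinE => /nbhs_ballP[d /= d0 dH].
exists (Num.min d 1); split.
- by rewrite lt_min d0 ltr01.
- by rewrite ge_min lexx orbT.
- move=> x n nk /andP[x0]; rewrite lt_min => /andP[xd _].
  by apply: (dH x) => //=; rewrite /ball/= sub0r normrN gtr0_norm.
Qed.

(* The sign of F - id alternates along x 0 < ... < x j.  Each sign is required on
   the whole interval [x i, B^r (x i)], because every one of the r remaining steps
   may shorten it on the right by one application of B. *)
Let pattern (a : R) (r j : nat) (F : R -> R) (x : nat -> R) : Prop :=
  [/\ G F, germ_lt id F,
      forall m r', r = r'.+1 -> germ_lt (iter m F) (s r'),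
      forall i, (i < j)%N -> x i < x i.+1 &
      forall i, (i <= j)%N -> [/\ 0 < x i, x i < a, iter r B (x i) < a &
        forall y, x i <= y <= iter r B (x i) ->
          if odd i then F y < y else y < F y]].

(** Take F' = F^-m s_r. Near 0 it is above the diagonal, since F^m < s_r for every m. On the old
    intervals, which stay away from 0, a large m lets F^-m outweigh s_r, so every old sign is
    reversed. A new leftmost point close to 0 restores the alternation. *)
Let pattern_step a r j F x :
  (forall x n, (n <= k)%N -> 0 < x < a -> x < s n x /\ s n x <= B x) ->
  0 < a -> (r < k)%N ->
  pattern a r.+1 j F x -> exists F' x', pattern a r j.+1 F' x'.
Proof.
move=> regH a0 rk [GF F1 Fs xinc xH].
have [GV FK KF] := cinvP HG GF; set V := cinv F in GV FK KF.
have GVm m := group_iter HG m GV.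
(* m applications of F^-1 carry one end of the i-th interval past the other end, in the direction
   opposite to that of F. *)
pose P i m := if odd i then iter r.+1 B (x i) < iter m V (x i)
              else iter m V (iter r.+1 B (x i)) < x i.
have Bmono y n : 0 < y < a -> iter n B y <= iter n.+1 B y.
  move=> /(regH _ 0%N isT)[yB _].
  by rewrite iterSr (group_le HG _ _ (GB n)) ltW.
have Bge y n : 0 < y < a -> y <= iter n B y.
  by move=> ya; elim: n => [//|n /le_trans]; apply; exact: Bmono.
have [m Pm] : exists m, forall i, (i <= j)%N -> P i m.
  apply: bounded_uniform => i /xH[x0 xa Bxa sgn].
  have xBx : x i <= iter r.+1 B (x i) by apply: Bge; rewrite x0.
  rewrite /P; case: (odd i) sgn => /= sgn.
    apply: (iter_exit HG GV xBx) => y /sgn Fy.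
    by rewrite -(group_lt HG _ _ GF) KF.
  have [n Hn] := iter_exit HG GF xBx sgn.
  exists n => l /Hn; rewrite -(group_lt HG _ _ (GVm l)).
  by rewrite -[iter l V (iter l F _)]/((iter l V \o iter l F) _) (iter_inv HG).
have Gg := Gs r; set g := s r in Gg.
have GF' := group_comp HG (GVm m) Gg; set F' := iter m V \o g in GF'.
have F'1 : germ_lt id F'.
  by have := germ_ltl HG (GVm m) (Fs m r erefl); rewrite (iter_inv HG).
(* F^-m lies below or at the identity, so F' is at most s_r and inherits its being infinitesimal
   against the next larger element. *)
have F's n r' : r = r'.+1 -> germ_lt (iter n F') (s r').
  move=> rr'; have : germ_lt (iter n g) (s r') by rewrite /g rr'; exact: sdec.
  apply: germ_le_lt_trans; apply: (germ_le_iter HG) => //.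
  apply: (germ_ler HG Gg (g := id)).
  rewrite -(iter_idf R m); apply: (germ_le_iter HG) => //; first exact: group_id.
  by right; exact: (germ_ltN HG).
have [x' [x'0 x'x x'a Bx'a x'sgn]] : exists x', [/\ 0 < x', x' < x 0,
    x' < a, iter r B x' < a & forall y, x' <= y <= iter r B x' -> y < F' y].
  move: F'1; rewrite /germ_lt near_withinE => /nbhs_ballP[d /= d0 dH].
  have [xx0 _ _ _] := xH 0%N isT.
  near (0:R)^'+ => x'; exists x'.
  have x'0 : 0 < x' by near: x'; exact: nbhs_right_gt.
  split => //.
    by near: x'; apply: (near_group HG (P := fun y => y < a) (GB r));
      exact: nbhs_right_lt.
  have Bd : iter r B x' < d.
    by near: x'; apply: (near_group HG (P := fun y => y < d) (GB r));
      exact: nbhs_right_lt.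
  move=> y /andP[/(lt_le_trans x'0) y0 /le_lt_trans/(_ Bd) yd].
  by apply: dH => //=; rewrite /ball/= sub0r normrN gtr0_norm.
(* Prepending x' shifts the old indices by one, so the parity test records the reversal of signs. *)
exists F', (fun i => if i is i'.+1 then x i' else x'); split=> //.
- by case=> [|i] // ij; exact: xinc.
- case=> [|i] // ij.
  have [xi0 xia Bxia sgn] := xH i ij.
  have xi : 0 < x i < a by rewrite xi0.
  have Br : iter r B (x i) < a := le_lt_trans (Bmono _ r xi) Bxia.
  split => // y /andP[xy yB]; have := Pm i ij; rewrite /P oddS.
  have ya : 0 < y < a by rewrite (lt_le_trans xi0)// (le_lt_trans yB).
  have [yg gB] := regH y r (ltnW rk) ya.
  case: (odd i) => /= H.
    apply: (le_lt_trans yB); apply: (le_lt_trans (Bmono _ r xi)).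
    apply: (lt_le_trans H); rewrite (group_le HG _ _ (GVm m)).
    exact: le_trans xy (ltW yg).
  apply: lt_le_trans xy; apply: le_lt_trans H.
  rewrite (group_le HG _ _ (GVm m)) (le_trans gB)//.
  by rewrite /= (group_le HG _ _ (Gs 0)).
Unshelve. all: by end_near. Qed.

Lemma no_infinitesimal_chain : False.
Proof.
have [a [a0 a1 regH]] := region.
have step j : (j <= k)%N -> exists F x, pattern a (k - j) j F x.
  elim: j => [_|j IH jk]; last first.
    have [|F [x]] := IH; first exact: ltnW.
    have -> : (k - j = (k - j.+1).+1)%N by lia.
    by move=> /pattern_step; apply => //; lia.
  near (0:R)^'+ => x; exists (s k), (fun=> x); rewrite subn0.
  have x0 : 0 < x by near: x; exact: nbhs_right_gt.
  have Bxa : iter k B x < a by near: x;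
    apply: (near_group HG (P := fun y => y < a) (GB k)); exact: nbhs_right_lt.
  split=> // [m r' [<-]|[|//] _]; first exact: sdec.
  split=> //.
  move=> y /andP[xy yB]; apply: (regH y k (leqnn _) _).1.
  by rewrite (lt_le_trans x0)// (le_lt_trans yB).
(* Now r = 0: the intervals have shrunk to the points x 0, ..., x (N + 1). *)
have [F [x]] := step k (leqnn _); rewrite subnn => -[GF F1 _ xinc xH].
have /choice[c cH] : forall i, exists c,
    (i <= N)%N -> x i < c < x i.+1 /\ F c = c.
  move=> i; have [iN|iN] := leqP i N; last by exists 0.
  have [|c ? ?] := fixed_between (group_cont HG GF) (xinc i iN); last by exists c.
  have [_ _ _ /(_ (x i))] := xH i (leqW iN); rewrite /= lexx => /(_ isT).
  have [_ _ _ /(_ (x i.+1))] := xH i.+1 iN; rewrite /= lexx => /(_ isT).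
  by case: (odd i) => /= ? ?; [right|left].
apply: (fixN GF _ (c := c)).
- by move=> E; rewrite E in F1; exact: germ_ltxx F1.
- move=> i iN; have [/andP[xc cx] Fc] := cH i iN; split=> //.
  have [x0 _ _ _] := xH i (leqW iN); have [_ xa _ _] := xH i.+1 iN.
  by rewrite (lt_trans x0)//= (lt_trans cx)// (lt_le_trans xa).
- move=> i iN; have [/andP[_ ci] _] := cH i (ltnW iN).
  by have [/andP[ic _] _] := cH i.+1 iN; exact: lt_trans ci ic.
Unshelve. all: by end_near. Qed.

End Chain.

Lemma exists_germ_minimal f : G f -> germ_lt id f -> exists t, germ_minimal G t.
Proof.
move=> Gf f1; apply: contrapT => nomin.
have /choice[next nextH] : forall g, exists h, G g -> germ_lt id g ->
    [/\ G h, germ_lt id h & forall n, germ_lt (iter n h) g].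
  move=> g; apply: contrapT => noh; apply: nomin; exists g.
  have [Gg g1] : G g /\ germ_lt id g.
    by apply: contrapT => H; apply: noh; exists id => Gg g1; case: H.
  split=> // h Gh h1 hg; apply: noh; by exists h.
have Hs n : G (iter n next f) /\ germ_lt id (iter n next f).
  elim: n => [//|n [Gn n1]]; rewrite iterS.
  by have [] := nextH _ Gn n1.
apply: (@no_infinitesimal_chain (fun n => iter n next f)) => [n|n|n m].
- exact: (Hs n).1.
- exact: (Hs n).2.
- by have [Gn n1] := Hs n; have [_ _] := nextH _ Gn n1.
Qed.

End FiniteRank.

(** * The smallest archimedean class *)

(** The convex subgroup generated by t; the second inequality is t^-n < f written without
    inverses. *)
Definition minimal_class (R : realType) (G : set (R -> R)) (t : R -> R) :
    set (R -> R) :=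
  [set f | G f /\ exists n, germ_lt f (iter n t) /\ germ_lt id (f \o iter n t)].

Lemma interval_group_sub (R : realType) (A G : set (R -> R)) :
  interval_group G -> transf_group A -> A `<=` G -> interval_group A.
Proof.
by move=> [_ H1 H2 H3 H4] TA AG; split=> // f /AG; [apply: H1|apply: H2|
  apply: H3|apply: H4].
Qed.

Section OrderHom.
Variables (R : realType) (G : set (R -> R)) (tau : (R -> R) -> R).
Hypothesis HG : interval_group G.
Hypothesis tauD : forall f g, G f -> G g -> tau (f \o g) = tau f + tau g.
Hypothesis tau_gt0 : forall f, G f -> germ_lt id f -> 0 < tau f.

Lemma hom_id : tau id = 0.
Proof.
have := tauD (group_id HG) (group_id HG); rewrite -[id \o id]/id => H.
by apply/eqP; rewrite -(subrr (tau id)) {2}H addrK.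
Qed.

Lemma hom_inv f : G f -> tau (cinv f) = - tau f.
Proof.
move=> Gf; have := tauD (group_inv HG Gf) Gf.
by rewrite (cinvK HG)// hom_id => /eqP; rewrite eq_sym addr_eq0 => /eqP.
Qed.

Lemma hom_iter n f : G f -> tau (iter n f) = n%:R * tau f.
Proof.
move=> Gf; elim: n => [|n IH]; first by rewrite mul0r hom_id.
by rewrite iterSf tauD ?IH//; [rewrite -natr1; ring|exact: group_iter].
Qed.

Lemma hom_iterz z f : G f -> tau (iterz f z) = z%:~R * tau f.
Proof.
move=> Gf; case: z => n; first exact: hom_iter.
rewrite -[iterz _ _]/(iter n.+1 (cinv f)) hom_iter; last exact: group_inv.
by rewrite hom_inv// NegzE mulrNz mulrN mulNr.
Qed.

Lemma hom_lt f g : G f -> G g -> germ_lt f g -> tau f < tau g.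
Proof.
move=> Gf Gg fg; have := tau_gt0 (group_comp HG (group_inv HG Gf) Gg).
move=> /(_ (germ_ltVl HG Gf fg)); rewrite (tauD (group_inv HG Gf) Gg).
by rewrite hom_inv// addrC subr_gt0.
Qed.

Lemma hom_inj f g : G f -> G g -> tau f = tau g -> f = g.
Proof.
move=> Gf Gg fg; case: (germ_total HG Gf Gg) => // H.
  by have := hom_lt Gf Gg H; rewrite fg ltxx.
by have := hom_lt Gg Gf H; rewrite fg ltxx.
Qed.

Lemma hom_comm f g : G f -> G g -> f \o g = g \o f.
Proof.
by move=> Gf Gg; apply: hom_inj; [exact: group_comp|exact: group_comp|
  rewrite (tauD Gf Gg) (tauD Gg Gf) addrC].
Qed.

Lemma hom_free_lt f g x : free_action G -> G f -> G g -> 0 < x < 1 ->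
  (f x < g x) = (tau f < tau g).
Proof.
move=> free Gf Gg x01.
case: (germ_total HG Gf Gg) => [->|fg|gf]; first by rewrite !ltxx.
- by rewrite (free_lt HG free Gf Gg fg)// hom_lt.
- have := hom_lt Gg Gf gf; have := free_lt HG free Gg Gf gf x01.
  by move=> /lt_gtF -> /lt_gtF ->.
Qed.

End OrderHom.

Section MinimalClass.
Variables (R : realType) (G : set (R -> R)) (t : R -> R).
Hypothesis HG : interval_group G.
Hypothesis mint : germ_minimal G t.

Let Gt : G t. Proof. by case: mint. Qed.
Let t1 : germ_lt id t. Proof. by case: mint. Qed.
Let A := minimal_class G t.

Let itn n : G (iter n t) := group_iter HG n Gt.

Lemma cinv_finv f : G f -> cinv (cinv f) = f.
Proof.
move=> Gf; have [GV fK Kf] := cinvP HG Gf; have [_ c _] := cinvP HG GV.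
by apply/funext => y; rewrite -{1}[y]fK c.
Qed.

Lemma iter_conj n g f : G g ->
  iter n (g \o f \o cinv g) = g \o iter n f \o cinv g.
Proof.
move=> Gg; elim: n => [|n IH]; first by rewrite [LHS](esym (cinvVK HG Gg)).
rewrite iterSf IH -[LHS]/(g \o f \o (cinv g \o g) \o iter n f \o cinv g).
by rewrite (cinvK HG).
Qed.

(** Otherwise every t^n is at most g t g^-1. Conjugating back, all powers of g^-1 t g stay below t,
    against minimality; passing from n to n + 1 makes the bound strict. *)
Lemma minimal_conj_bound g : G g ->
  exists n, germ_lt (g \o t \o cinv g) (iter n t).
Proof.
move=> Gg; apply: contrapT => no.
have GV := group_inv HG Gg.
have Gc := group_comp HG (group_comp HG Gg Gt) GV.
have Gc' := group_comp HG (group_comp HG GV Gt) Gg.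
have [_ _ minH] := mint.
have H n : germ_le (iter n t) (g \o t \o cinv g).
  by apply: (germ_leNgt HG) => // H; apply: no; exists n.
apply: (minH (cinv g \o t \o g)) => //.
- have /(germ_ltl HG GV)/(germ_ltr HG Gg) := t1.
  by rewrite -[_ \o id \o g]/(cinv g \o g) (cinvK HG).
move=> n; have E m : iter m (cinv g \o t \o g) = cinv g \o iter m t \o g.
  by rewrite -{2}(cinv_finv Gg) iter_conj// cinv_finv.
have lt1 : germ_lt (iter n t) (iter n.+1 t).
  by apply: (germ_ltr HG (h := iter n t) (f := id)).
have := germ_lt_le_trans lt1 (H n.+1).
move=> /(germ_ltl HG GV)/(germ_ltr HG Gg); rewrite E.
rewrite -[X in germ_lt _ X]/((cinv g \o g) \o t \o (cinv g \o g)).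
by rewrite (cinvK HG).
Qed.

Lemma minimal_class_group : transf_group A.
Proof.
split.
- split; first exact: group_id.
  by exists 1%N; split; exact: t1.
- move=> f g [Gf [n [f1 f2]]] [Gg [m [g1 g2]]].
  split; first exact: group_comp.
  exists (n + m)%N; split.
    rewrite iter_comp; apply: (@germ_lt_trans _ (f \o iter m t)).
      exact: (germ_ltl HG).
    exact: (germ_ltr HG).
  rewrite addnC iter_comp.
  have := germ_ltl HG Gf (germ_ltr HG (itn n) g2).
  exact: germ_lt_trans.
- move=> f [Gf [n [f1 f2]]]; have [GV fK Kf] := cinvP HG Gf.
  exists (cinv f); split=> //; split=> //; exists n; split.
    have := germ_ltl HG GV f2.
    by rewrite -[X in germ_lt _ X]/((cinv f \o f) \o _) (cinvK HG).
  by have := germ_ltl HG GV f1; rewrite (cinvK HG).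
Qed.

Lemma minimal_class_interval : interval_group A.
Proof.
by apply: (interval_group_sub HG minimal_class_group) => f [].
Qed.

Lemma minimal_class_mem : A t.
Proof.
have t2 : germ_lt t (iter 2 t) := germ_ltr HG Gt t1.
(* The bounds in the class are strict, so n = 1 would not do. *)
split=> //; exists 2%N; split=> //; apply: (germ_lt_trans t1).
exact: (germ_ltl HG Gt (germ_lt_trans t1 t2)).
Qed.

Lemma minimal_class_archimedean : archimedean_germs A.
Proof.
move=> f g [Gf _] [Gg [m [g1 _]]] f1.
have [_ _ minH] := mint.
have [n tf] : exists n, germ_le t (iter n f).
  apply: contrapT => no; apply: (minH f Gf f1) => n.
  have [E|H|H] := germ_total HG (group_iter HG n Gf) Gt.
  - by exfalso; apply: no; exists n; rewrite E; left.
  - exact: H.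
  - by exfalso; apply: no; exists n; right.
exists (m * n)%N; apply: germ_lt_le_trans g1 _; rewrite iter_mul.
by apply: (germ_le_iter HG) => //; exact: group_iter.
Qed.

Lemma minimal_class_normal g f : G g -> A f -> A (g \o f \o cinv g).
Proof.
move=> Gg [Gf [n [f1 f2]]]; have GV := group_inv HG Gg.
have [m gm] := minimal_conj_bound Gg.
split; first by apply: (group_comp HG) => //; exact: group_comp.
have Gc := group_comp HG (group_comp HG Gg Gt) GV.
have le1 : germ_le (g \o iter n t \o cinv g) (iter (n * m) t).
  rewrite -iter_conj// iter_mul; apply: (germ_le_iter HG) => //.
  by right.
exists (n * m)%N; split.
  apply: germ_lt_le_trans le1; apply: (germ_ltr HG) => //.
  exact: (germ_ltl HG).
have Gfc : G (g \o f \o cinv g).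
  by apply: (group_comp HG) => //; exact: group_comp.
apply: germ_lt_le_trans (germ_lel HG Gfc le1).
rewrite -[X in germ_lt _ X]/(g \o f \o (cinv g \o g) \o iter n t \o cinv g).
rewrite (cinvK HG)//.
have := germ_ltl HG Gg (germ_ltr HG GV f2).
by rewrite -[X in germ_lt X _]/(g \o cinv g) (cinvVK HG).
Qed.

End MinimalClass.

Section NormalFree.
Variables (R : realType) (G A : set (R -> R)) (tau : (R -> R) -> R).
Hypotheses (HG : interval_group G) (HA : interval_group A) (AG : A `<=` G).
Hypothesis normA : forall g f, G g -> A f -> A (g \o f \o cinv g).
Hypothesis commA : forall f g, A f -> A g -> f \o g = g \o f.
Hypothesis irr : forall x : R, 0 < x < 1 -> exists2 g, G g & g x <> x.

Lemma least_fixed f (p : R) : G f -> f <> id -> 0 < p < 1 -> f p = p ->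
  exists q : R,
    [/\ 0 < q < 1, f q = q & forall x : R, 0 < x < 1 -> f x = x -> q <= x].
Proof.
move=> Gf fid p01 fp; pose F := [set x : R | 0 < x < 1 /\ f x = x].
have Fp : F p by [].
have [d d0 dF] : exists2 d, 0 < d & lbound F d.
  have [_ _ _ _ /(_ _ Gf fid)] := HG.
  rewrite near_withinE => /nbhs_ballP[d /= d0 dH]; exists d => // x [x01 fx].
  rewrite leNgt; apply/negP => xd; apply: (dH x) => //=; last by case/andP: x01.
  by rewrite /ball/= sub0r normrN gtr0_norm//; case/andP: x01.
have infF : has_inf F by split; [exists p|exists d].
have lb x : 0 < x < 1 -> f x = x -> inf F <= x.
  by move=> x01 fx; apply: ge_inf => //; exact: infF.2.
(* An increasing map that fixes [F] pointwise cannot raise its infimum. Applied to f and to f^-1,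
   this shows that the infimum is itself fixed. *)
have up g : G g -> (forall x, F x -> g x = x) -> g (inf F) <= inf F.
  move=> Gg gF; rewrite leNgt; apply/negP => /(inf_lt infF.1)[x Fx].
  rewrite -{1}(gF _ Fx) (group_lt HG)// ltNge; case: Fx => x01 fx.
  by rewrite lb.
have [GV fK _] := cinvP HG Gf.
exists (inf F); split=> //.
- have infF1 : inf F < 1.
    by case/andP: (p01) => _; apply: le_lt_trans; exact: lb.
  by rewrite infF1 andbT; apply: (lt_le_trans d0); apply: lb_le_inf => //;
    exact: infF.1.
- have le1 : f (inf F) <= inf F by apply: up => // x [].
  have le2 : cinv f (inf F) <= inf F.
    by apply: up => // x [_ fx]; rewrite -{1}fx fK.
  by apply/le_anti; rewrite le1 -(group_le HG _ _ GV) fK.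
Qed.

(** Let q be the least fixed point of f. If f fixes both g q and g^-1 q, then q is at most each of
    them, so g q = q. This applies to g in A, which commutes with f; hence A fixes q. By normality
    g^-1 f g then fixes q for every g in G, so f fixes g q, and the same argument makes q a global
    fixed point. *)
Lemma normal_free : free_action A.
Proof.
move=> f Af fid p p01 fp; have Gf := AG Af.
have [q [q01 fq qmin]] := least_fixed Gf fid p01 fp.
have stab g : G g -> (forall g', g' = g \/ g' = cinv g -> f (g' q) = g' q) ->
    g q = q.
  move=> Gg H; have [GV gK Kg] := cinvP HG Gg.
  have in01 g' : G g' -> 0 < g' q < 1.
    by move=> Gg'; rewrite (group_gt0 HG)// (group_lt1 HG).
  apply/le_anti/andP; split; last first.
    by apply: qmin; [exact: in01|apply: H; left].
  rewrite -(group_le HG _ _ GV) gK.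
  by apply: qmin; [exact: in01|apply: H; right].
have stabA g : A g -> g q = q.
  move=> Ag; apply: stab; first exact: AG.
  have comm g' : A g' -> f (g' q) = g' q.
    by move=> Ag'; rewrite -[LHS]/((f \o g') q) (commA Af Ag') /= fq.
  by move=> g' [->|->]; apply: comm => //; exact: (group_inv HA).
have [g Gg] := irr q01; apply; apply: stab => // g'.
have comm g'' : G g'' -> f (g'' q) = g'' q.
  move=> Gg''; have [GV gK Kg] := cinvP HG Gg''.
  have := stabA _ (normA GV Af); rewrite (cinv_finv HG)//= => E.
  by rewrite -{2}E Kg.
by move=> [->|->]; apply: comm => //; exact: group_inv.
Qed.

End NormalFree.

(** * The affine chart *)

Lemma bernoulli_expr (R : realType) (l : R) n : 1 <= l ->
  1 + n%:R * (l - 1) <= l ^+ n.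
Proof.
move=> l1; elim: n => [|n IH]; first by rewrite mul0r addr0 expr0.
rewrite exprS -natr1.
have : 0 <= n%:R * (l - 1) ^+ 2 by rewrite mulr_ge0 ?sqr_ge0.
nra.
Qed.

Lemma expr_unbounded (R : realType) (l M : R) : 1 < l -> exists n, M < l ^+ n.
Proof.
move=> l1; exists (Num.trunc (M / (l - 1))).+1.
apply: lt_le_trans (bernoulli_expr _ (ltW l1)).
have := truncnS_gt (M / (l - 1)); rewrite ltr_pdivrMr ?subr_gt0//; lra.
Qed.

(** Uniqueness in Hoelder's theorem: if the normalised values at f differ, a rational z / n strictly
    between them gives an element f^n t^-z on which the two homomorphisms have opposite signs. *)
Lemma hom_proportional (R : realType) (A : set (R -> R))
    (tau tau' : (R -> R) -> R) (t f : R -> R) :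
  interval_group A ->
  (forall f g, A f -> A g -> tau (f \o g) = tau f + tau g) ->
  (forall f, A f -> germ_lt id f -> 0 < tau f) ->
  (forall f g, A f -> A g -> tau' (f \o g) = tau' f + tau' g) ->
  (forall f, A f -> germ_lt id f -> 0 < tau' f) ->
  A t -> germ_lt id t -> A f -> tau' f = tau' t / tau t * tau f.
Proof.
move=> HA; wlog H : tau tau' / tau f * tau' t < tau' f * tau t.
  move=> W D P D' P' At t1 Af.
  have T := P _ At t1; have T' := P' _ At t1.
  have [H|H|H] := ltgtP (tau f * tau' t) (tau' f * tau t).
  - exact: W.
  - have E := W tau' tau H D' P' D P At t1 Af.
    by rewrite E; field; rewrite !gt_eqF.
  - by rewrite mulrAC (mulrC (tau' t)) H mulfK// gt_eqF.
move=> D P D' P' At t1 Af; exfalso.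
have T := P _ At t1; have T' := P' _ At t1.
have {}H : tau f / tau t < tau' f / tau' t.
  by rewrite ltr_pdivrMr// mulrAC ltr_pdivlMr.
set x := tau f / tau t in H; set y := tau' f / tau' t in H.
have [n Hn] : exists n : nat, 1 < n%:R * (y - x).
  exists (Num.trunc (1 / (y - x))).+1.
  by rewrite -ltr_pdivrMr ?subr_gt0//; exact: truncnS_gt.
pose z := Num.floor (n%:R * x) + 1.
have z1 : n%:R * x < z%:~R by exact: lt_succ_floor.
have z2 : z%:~R < n%:R * y.
  have := floor_le_tmp (n%:R * x); rewrite /z intrD; lra.
have Afn := group_iter HA n Af; have Atz := group_iterz HA (- z) At.
have Ab := group_comp HA Afn Atz; set b := _ \o _ in Ab.
have b0 : tau b < 0.
  rewrite D// (hom_iter HA D)// (hom_iterz HA D)// intrN mulNr subr_lt0.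
  by rewrite -ltr_pdivrMr// -mulrA.
have b0' : 0 < tau' b.
  rewrite D'// (hom_iter HA D')// (hom_iterz HA D')// intrN mulNr subr_gt0.
  by rewrite -ltr_pdivlMr// -mulrA.
case: (germ_total HA (group_id HA) Ab) => [E|E|E].
- by move: b0; rewrite -E (hom_id HA D) ltxx.
- by have := lt_trans b0 (P _ Ab E); rewrite ltxx.
- have := hom_lt HA D' P' Ab (group_id HA) E; rewrite (hom_id HA D').
  by move=> /(lt_trans b0'); rewrite ltxx.
Qed.

(** All that the chart needs from the smallest class, whatever its origin. *)
Record normal_translations (R : realType) (G A : set (R -> R))
    (tau : (R -> R) -> R) (t : R -> R) : Prop := NormalTranslations {
  nt_group : interval_group A;
  nt_sub : A `<=` G;
  nt_normal : forall g f, G g -> A f -> A (g \o f \o cinv g);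
  nt_hom : forall f g, A f -> A g -> tau (f \o g) = tau f + tau g;
  nt_pos : forall f, A f -> germ_lt id f -> 0 < tau f;
  nt_free : free_action A;
  nt_mem : A t;
  nt_gt : germ_lt id t }.

Section Semiconjugacy.
Variables (R : realType) (G A : set (R -> R)) (tau : (R -> R) -> R).
Variable t : R -> R.
Hypotheses (HG : interval_group G) (HT : normal_translations G A tau t).
Implicit Types (a f g h : R -> R) (p x y u v : R).

Let HA := nt_group HT.
Let AG := nt_sub HT.
Let normA := nt_normal HT.
Let tauD := nt_hom HT.
Let tau_gt0 := nt_pos HT.
Let freeA := nt_free HT.
Let At := nt_mem HT.
Let t1 := nt_gt HT.
Let Gt : G t := AG At.
Let tt0 : 0 < tau t. Proof. exact: tau_gt0. Qed.

Let in01 g x : G g -> 0 < x < 1 -> 0 < g x < 1.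
Proof. by move=> Gg x01; rewrite (group_gt0 HG)// (group_lt1 HG). Qed.

Let tauV f : A f -> tau (cinv f) = - tau f.
Proof. exact: hom_inv. Qed.

Lemma translation_escape u v : 0 < u < 1 -> 0 < v < 1 ->
  exists n, v < iter n t u.
Proof.
move=> u01 v01; have [uv|vu] := leP u v; last by exists 0%N.
have [|n Hn] := iter_exit HA At uv; last by exists n; apply: Hn.
move=> x /andP[ux xv]; apply: (free_lt HA freeA (group_id HA) At t1).
by case/andP: u01 => u0 _; case/andP: v01 => _ v1;
  rewrite (lt_le_trans u0)// (le_lt_trans xv).
Qed.

Lemma translation_escapeV u v : 0 < u < 1 -> 0 < v < 1 ->
  exists n, iter n (cinv t) u < v.
Proof.
move=> u01 v01; have [n Hn] := translation_escape v01 u01; exists n.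
have Gn := group_iter HG n (group_inv HG Gt).
have /= E := congr1 (fun f => f v) (iter_inv HG n Gt).
by rewrite -(group_lt HG u _ Gn) E in Hn.
Qed.

(** The slope of the affine map that g becomes: conjugation by an affine map of slope l multiplies
    translation lengths by l. *)
Definition dilation g := tau (g \o t \o cinv g) / tau t.

Let conj_comp g a b : G g ->
  g \o (a \o b) \o cinv g = (g \o a \o cinv g) \o (g \o b \o cinv g).
Proof.
move=> Gg; rewrite -[RHS]/(g \o a \o (cinv g \o g) \o b \o cinv g).
by rewrite (cinvK HG).
Qed.

Let conj_pos g a : G g -> germ_lt id a -> germ_lt id (g \o a \o cinv g).
Proof.
move=> Gg /(germ_ltl HG Gg)/(germ_ltr HG (group_inv HG Gg)).
by rewrite -[X in germ_lt X _]/(g \o cinv g) (cinvVK HG).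
Qed.

Lemma tau_conj g a : G g -> A a -> tau (g \o a \o cinv g) = dilation g * tau a.
Proof.
move=> Gg Aa.
apply: (hom_proportional (tau' := fun a => tau (g \o a \o cinv g)) HA) => //.
- move=> f f' Af Af'; rewrite conj_comp// tauD//; exact: normA.
- by move=> f Af f1; apply: tau_gt0; [exact: normA|exact: conj_pos].
Qed.

Lemma dilation_gt0 g : G g -> 0 < dilation g.
Proof.
by move=> Gg; rewrite divr_gt0// tau_gt0//; [exact: normA|exact: conj_pos].
Qed.

Lemma dilationV g : G g -> dilation g * dilation (cinv g) = 1.
Proof.
move=> Gg; have GV := group_inv HG Gg.
have := tau_conj Gg (normA GV At); rewrite (tau_conj GV At).
rewrite (cinv_finv HG)// -[X in tau X]/((g \o cinv g) \o t \o (g \o cinv g)).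
rewrite (cinvVK HG)// -[id \o t \o id]/t => H.
by apply: (mulIf (lt0r_neq0 tt0)); rewrite mul1r -mulrA -H.
Qed.

(** With factor 1, h would commute with t and fix every t^-n p; these points tend to 0, where fixed
    points of h cannot accumulate. *)
Lemma fixed_dilation h p : G h -> h <> id -> 0 < p < 1 -> h p = p ->
  dilation h != 1.
Proof.
move=> Gh hid p01 hp; apply/eqP => d1.
have E : h \o t \o cinv h = t.
  by apply: (hom_inj HA tauD tau_gt0) => //; [exact: normA|
    rewrite tau_conj// d1 mul1r].
have comm x : h (cinv t x) = cinv t (h x).
  have [_ tK Kt] := cinvP HA At; have [_ hK _] := cinvP HG Gh.
  have /= := congr1 (fun f => f (h (cinv t x))) E.
  by rewrite hK Kt => ->; rewrite tK.
have hn n : h (iter n (cinv t) p) = iter n (cinv t) p.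
  by elim: n => [//|n IH]; rewrite iterS comm IH.
have [_ _ _ _ /(_ _ Gh hid)] := HG.
rewrite near_withinE => /nbhs_ballP[d /= d0 dH].
have d01 : 0 < Num.min d 2^-1 < 1.
  rewrite lt_min d0 gt_min/=; apply/andP; split; [|apply/orP; right]; lra.
have [n Hn] := translation_escapeV p01 d01.
have /andP[n0 _] := in01 (group_iter HG n (group_inv HG Gt)) p01.
apply: (dH (iter n (cinv t) p)) => //=; rewrite /ball/= sub0r normrN gtr0_norm//.
by apply: lt_le_trans Hn _; rewrite ge_min lexx.
Qed.

Lemma expanding_element h p : G h -> h <> id -> 0 < p < 1 -> h p = p ->
  exists g, [/\ G g, g p = p & 1 < dilation g].
Proof.
move=> Gh hid p01 hp; have := fixed_dilation Gh hid p01 hp.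
have [d1|d1 _|//] := ltgtP (dilation h) 1; last by exists h.
move=> _; have [GV hK _] := cinvP HG Gh.
exists (cinv h); split=> //; first by rewrite -{1}hp hK.
have := dilationV Gh; have := dilation_gt0 Gh; have := dilation_gt0 GV; nra.
Qed.

Section Psi.
Variable h : R -> R.
Hypotheses (Gh : G h) (h1 : 1 < dilation h).

(** Conjugating t repeatedly by h^-1 divides its translation length by a factor greater than 1, so
    [tau] takes arbitrarily small positive values; integer multiples of one shorter than s - r meet
    the gap. *)
Lemma tau_dense (r s : R) : r < s -> exists2 a, A a & r < tau a < s.
Proof.
move=> rs.
have small n : exists2 a, A a & tau a * dilation h ^+ n = tau t.
  elim: n => [|n [a Aa aE]]; first by exists t; rewrite // mulr1.
  have GV := group_inv HG Gh; have Ac := normA GV Aa.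
  exists (cinv h \o a \o cinv (cinv h)) => //.
  rewrite -aE exprS mulrA [_ * dilation h]mulrC -tau_conj// (cinv_finv HG)//.
  rewrite -[X in tau X]/((h \o cinv h) \o a \o (h \o cinv h)).
  by rewrite (cinvVK HG).
have [n Hn] := expr_unbounded (tau t / (s - r)) h1.
have [a Aa aE] := small n.
have e0 : 0 < dilation h ^+ n by rewrite exprn_gt0// (lt_trans ltr01).
have a0 : 0 < tau a by rewrite -(pmulr_lgt0 _ e0) aE.
have as_ : tau a < s - r.
  by move: Hn; rewrite ltr_pdivrMr ?subr_gt0// mulrC -aE ltr_pM2r.
exists (iterz a (Num.floor (r / tau a) + 1)); first exact: group_iterz.
rewrite (hom_iterz HA tauD)// -ltr_pdivrMr// lt_succ_floor/=.
have := floor_le_tmp (r / tau a); rewrite ler_pdivlMr// intrD; lra.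
Qed.

Let x0 : R := 2^-1.
Let x001 : 0 < x0 < 1. Proof. by rewrite /x0; lra. Qed.
Let below (x : R) : set R := [set r | exists a, [/\ A a, a x0 <= x & r = tau a]].

Definition affine_chart x := sup (below x).
Notation Psi := affine_chart.

Let tau_lt f g x : A f -> A g -> 0 < x < 1 -> (f x < g x) = (tau f < tau g).
Proof. exact: hom_free_lt. Qed.

Let below_ub x : 0 < x < 1 -> has_ubound (below x).
Proof.
move=> x01; have [n Hn] := translation_escape x001 x01.
have Atn := group_iter HA n At.
exists (tau (iter n t)) => _ [a [Aa ax ->]]; apply/ltW.
by rewrite -(tau_lt _ _ x001)// (le_lt_trans ax).
Qed.

Let below_ex x : 0 < x < 1 -> below x !=set0.
Proof.
move=> x01; have [n Hn] := translation_escapeV x001 x01.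
exists (tau (iter n (cinv t))), (iter n (cinv t)); split; last by [].
  exact: group_iter (group_inv HA At).
exact: ltW.
Qed.

Lemma chart_ge a x : A a -> 0 < x < 1 -> a x0 <= x -> tau a <= Psi x.
Proof. by move=> Aa x01 ax; apply: ub_le_sup; [exact: below_ub|exists a]. Qed.

Lemma chart_le x r : 0 < x < 1 -> (forall a, A a -> a x0 <= x -> tau a <= r) ->
  Psi x <= r.
Proof.
move=> x01 H; apply: ge_sup; first exact: below_ex.
by move=> _ [a [Aa ax ->]]; exact: H.
Qed.

Lemma chart_le_tau a x : A a -> 0 < x < 1 -> x <= a x0 -> Psi x <= tau a.
Proof.
move=> Aa x01 xa; apply: chart_le => // b Ab bx.
by rewrite leNgt -(tau_lt _ _ x001)// -leNgt (le_trans bx).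
Qed.

Lemma chart_mono x y : 0 < x < 1 -> 0 < y < 1 -> x <= y -> Psi x <= Psi y.
Proof.
by move=> x01 y01 xy; apply: chart_le => // a Aa ax; apply: chart_ge => //;
  exact: le_trans ax xy.
Qed.

Lemma chart_reflect x y : 0 < x < 1 -> 0 < y < 1 -> Psi x < Psi y -> x < y.
Proof.
move=> x01 y01; rewrite !ltNge; apply: contra; exact: chart_mono.
Qed.

Lemma chart_translation a x : A a -> 0 < x < 1 -> Psi (a x) = tau a + Psi x.
Proof.
(* The reverse inequality is this one for a^-1 at the point a x. *)
have le a' y : A a' -> 0 < y < 1 -> tau a' + Psi y <= Psi (a' y).
  move=> Aa y01; rewrite -lerBrDl; apply: chart_le => // b Ab bx.
  rewrite lerBrDl -tauD//.
  apply: chart_ge; [exact: group_comp|exact: in01 (AG Aa) _|].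
  by rewrite /= (group_le HA _ _ Aa).
move=> Aa x01; apply/le_anti; rewrite le// andbT.
have [AV aK _] := cinvP HA Aa.
have := le _ (a x) AV (in01 (AG Aa) x01).
by rewrite aK tauV// addrC lerBlDl.
Qed.

(** On the A-orbit of [x0] this is [tau_conj]. Elsewhere the lower bound follows from the supremum
    defining the chart, and the upper bound from the density of tau (A). *)
Lemma chart_affine g x : G g -> 0 < x < 1 ->
  Psi (g x) = dilation g * Psi x + Psi (g x0).
Proof.
move=> Gg x01; have d0 := dilation_gt0 Gg.
have gx0 := in01 Gg x001; have gx := in01 Gg x01.
have orb a : A a -> Psi (g (a x0)) = dilation g * tau a + Psi (g x0).
  move=> Aa; rewrite -tau_conj// -chart_translation//; last exact: normA.
  by have [_ gK _] := cinvP HG Gg; rewrite /= gK.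
apply/le_anti/andP; split; last first.
  rewrite -lerBrDr mulrC -ler_pdivlMr//; apply: chart_le => // a Aa ax.
  rewrite ler_pdivlMr// mulrC lerBrDr -orb//; apply: chart_mono => //.
    exact: in01 Gg (in01 (AG Aa) x001).
  by rewrite (group_le HG).
rewrite leNgt; apply/negP.
rewrite -ltrBrDr mulrC -ltr_pdivlMr// => /tau_dense[a Aa /andP[a1 a2]].
move: a2; rewrite ltr_pdivlMr// mulrC ltrBrDr -orb// ltNge => /negP; apply.
apply: chart_mono => //; first exact: in01 Gg (in01 (AG Aa) x001).
rewrite (group_le HG)// leNgt; apply/negP => /ltW ax.
by move: a1; rewrite ltNge chart_ge.
Qed.

Lemma chart_surj r : exists2 x : R, 0 < x < 1 & Psi x = r.
Proof.
(* The preimage of r is sup [W]: density of tau (A) excludes both strict inequalities. The elements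
   b and c keep it inside (0, 1). *)
pose W := [set y | exists a, [/\ A a, tau a < r & y = a x0]].
have [b Ab /andP[rb _]] : exists2 a, A a & r < tau a < r + 1.
  by apply: tau_dense; lra.
have [c Ac /andP[_ cr]] : exists2 a, A a & r - 1 < tau a < r.
  by apply: tau_dense; lra.
have ubW a : A a -> r <= tau a -> ubound W (a x0).
  move=> Aa ra _ [d [Ad dr ->]]; apply/ltW.
  by rewrite (tau_lt Ad Aa x001) (lt_le_trans dr).
have Wc : W (c x0) by exists c.
have W0 : W !=set0 by exists (c x0).
have Wu : has_ubound W by exists (b x0); apply: ubW => //; exact: ltW.
have x01 : 0 < sup W < 1.
  have /andP[c0 _] := in01 (AG Ac) x001; have /andP[_ b1] := in01 (AG Ab) x001.
  rewrite (lt_le_trans c0) ?(ub_le_sup Wu)//=; apply: le_lt_trans b1.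
  by apply: ge_sup => //; apply: ubW => //; exact: ltW.
exists (sup W) => //; apply/le_anti/andP; split; rewrite leNgt; apply/negP.
- move=> /tau_dense[a Aa /andP[ra aP]]; move: aP; rewrite ltNge => /negP; apply.
  by apply: chart_le_tau => //; apply: ge_sup => //; apply: ubW => //; exact: ltW.
- move=> /tau_dense[a Aa /andP[aP ar]]; move: aP; rewrite ltNge => /negP; apply.
  by apply: chart_ge => //; apply: ub_le_sup => //; exists a.
Qed.

End Psi.
End Semiconjugacy.

(** * Injectivity of the chart *)

(** A one-sided strict derivative: both x and y vary, because the argument for injectivity needs the
    distortion of intervals that do not start at 0. *)
Definition strict_deriv0 (R : realType) (f : R -> R) (mu : R) : Prop :=
  forall e : R, 0 < e -> exists2 d, 0 < d & forall x y, 0 <= x -> x <= y ->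
    y <= d -> `|f y - f x - mu * (y - x)| <= e * (y - x).

Section StrictDerivative.
Variable R : realType.
Implicit Types (f g : R -> R) (mu nu : R).

Lemma strict_deriv0_id : strict_deriv0 (@id R) 1.
Proof.
by move=> e e0; exists 1 => // x y _ xy _; rewrite mul1r subrr normr0
  mulr_ge0 ?subr_ge0// ltW.
Qed.

Lemma strict_deriv0_unique f mu nu :
  strict_deriv0 f mu -> strict_deriv0 f nu -> mu = nu.
Proof.
move=> Hm Hn; apply/eqP; rewrite -subr_eq0 -normr_le0 leNgt; apply/negP => e0.
set e := `|_| in e0.
have e3 : 0 < e / 3 by rewrite divr_gt0.
have [d1 d10 H1] := Hm _ e3; have [d2 d20 H2] := Hn _ e3.
pose d := Num.min d1 d2.
have d0 : 0 < d by rewrite lt_min d10.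
have dd1 : d <= d1 by rewrite ge_min lexx.
have dd2 : d <= d2 by rewrite ge_min lexx orbT.
have := H1 0 d (lexx _) (ltW d0) dd1; have := H2 0 d (lexx _) (ltW d0) dd2.
rewrite !subr0 => A2 A1.
have : e * d <= `|f d - f 0 - nu * d| + `|f d - f 0 - mu * d|.
  rewrite /e -[X in _ * X <= _](gtr0_norm d0) -normrM.
  have -> : (mu - nu) * d = (f d - f 0 - nu * d) - (f d - f 0 - mu * d) by ring.
  exact: ler_normB.
have : 0 < e * d by rewrite mulr_gt0.
nra.
Qed.

Lemma strict_deriv0_comp f g mu nu : g 0 = 0 ->
  (forall x y, x <= y -> g x <= g y) ->
  strict_deriv0 f mu -> strict_deriv0 g nu -> strict_deriv0 (f \o g) (mu * nu).
Proof.
move=> g0 gmono Hf Hg e e0.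
(* Near 0, g is Lipschitz with constant K as soon as its error is at most 1. The errors of f and g
   then contribute e / 2 each, after multiplication by K and by a bound M of the slope of f. *)
pose K := `|nu| + 1; have K0 : 0 < K by rewrite ltr_wpDl.
pose M := `|mu| + 1; have M0 : 0 < M by rewrite ltr_wpDl.
have e1 : 0 < e / (2 * K) by rewrite divr_gt0// mulr_gt0.
have e2 : 0 < Num.min 1 (e / (2 * M)).
  by rewrite lt_min ltr01 divr_gt0// mulr_gt0.
have [d1 d10 H1] := Hf _ e1; have [d2 d20 H2] := Hg _ e2.
set e1' := e / (2 * K) in H1; set e2' := Num.min _ _ in H2.
have e1E : e1' * K = e / 2 by rewrite /e1'; field; rewrite gt_eqF.
have e2E : M * e2' <= e / 2.
  rewrite mulrC -ler_pdivlMr// /e2' ge_min; apply/orP; right.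
  by rewrite invfM mulrA.
have e2'1 : e2' <= 1 by rewrite ge_min lexx.
exists (Num.min d2 (d1 / K)).
  by rewrite lt_min d20 divr_gt0.
move=> x y x0 xy; rewrite le_min => /andP[yd2 ydK].
have lip u v : 0 <= u -> u <= v -> v <= d2 -> g v - g u <= K * (v - u).
  move=> u0 uv vd; have := H2 u v u0 uv vd; rewrite ler_norml => /andP[_ H].
  have : nu * (v - u) <= `|nu| * (v - u).
    by rewrite ler_wpM2r ?subr_ge0// ler_norm.
  have : e2' * (v - u) <= 1 * (v - u) by rewrite ler_wpM2r ?subr_ge0.
  rewrite /K; lra.
have y0 := le_trans x0 xy.
have gy : g y <= d1.
  have := lip 0 y (lexx _) y0 yd2; rewrite g0 !subr0 => /le_trans; apply.
  by rewrite mulrC -ler_pdivlMr.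
have gx0 : 0 <= g x by rewrite -g0; exact: gmono.
have A1 := H1 (g x) (g y) gx0 (gmono _ _ xy) gy.
have A2 := H2 x y x0 xy yd2.
have A3 := lip x y x0 xy yd2.
rewrite /=.
have -> : f (g y) - f (g x) - mu * nu * (y - x) =
    (f (g y) - f (g x) - mu * (g y - g x)) + mu * (g y - g x - nu * (y - x)).
  by ring.
apply: le_trans (ler_normD _ _) _.
have B1 : e1' * (g y - g x) <= e / 2 * (y - x).
  by rewrite -e1E -mulrA ler_wpM2l// ltW.
have B2 : `|mu * (g y - g x - nu * (y - x))| <= e / 2 * (y - x).
  rewrite normrM; apply: le_trans (_ : M * (e2' * (y - x)) <= _).
    by apply: ler_pM => //; rewrite /M lerDl.
  by rewrite mulrA ler_wpM2r ?subr_ge0.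
lra.
Qed.

End StrictDerivative.

Section Derivatives.
Variables (R : realType) (G : set (R -> R)).
Hypothesis HG : interval_group G.
Hypothesis derivG : forall f, G f -> exists mu, strict_deriv0 f mu.

Let comp f g mu nu : G g -> strict_deriv0 f mu -> strict_deriv0 g nu ->
  strict_deriv0 (f \o g) (mu * nu).
Proof.
move=> Gg Hf Hg; apply: strict_deriv0_comp Hf Hg => [|x y xy].
  exact: (group0 HG).
by rewrite (group_le HG).
Qed.

Let inv f mu nu : G f -> strict_deriv0 f mu -> strict_deriv0 (cinv f) nu ->
  mu * nu = 1.
Proof.
move=> Gf Hf Hv; have := comp (group_inv HG Gf) Hf Hv.
rewrite (cinvVK HG)// => /strict_deriv0_unique; apply; exact: strict_deriv0_id.
Qed.

Lemma deriv_gt0 f mu : G f -> strict_deriv0 f mu -> 0 < mu.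
Proof.
move=> Gf Hf; have [nu /(inv Gf Hf) mn] := derivG (group_inv HG Gf).
have mu0 : mu != 0 by apply/eqP => E; move: mn; rewrite E mul0r => /esym/eqP;
  rewrite oner_eq0.
rewrite lt_neqAle eq_sym mu0/= leNgt; apply/negP => m0.
(* For mu < 0 the error -mu / 2 would make f d negative. *)
have [|d d0 /(_ 0 d (lexx _) (ltW d0) (lexx _))] := Hf (- mu / 2).
  by rewrite divr_gt0// oppr_gt0.
rewrite (group0 HG Gf) !subr0 ler_norml => /andP[_].
have : 0 < f d by rewrite (group_gt0 HG).
nra.
Qed.

(** By the chain rule the derivatives of g and g^-1 at 0 cancel. *)
Lemma deriv_conj f g mu : G f -> G g -> strict_deriv0 f mu ->
  strict_deriv0 (g \o f \o cinv g) mu.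
Proof.
move=> Gf Gg Hf; have GV := group_inv HG Gg.
have [nu Hg] := derivG Gg; have [nu' Hv] := derivG GV.
have := comp GV (comp Gf Hg Hf) Hv.
by rewrite mulrAC (inv Gg Hg Hv) mul1r.
Qed.

End Derivatives.

Section Injectivity.
Variables (R : realType) (G A : set (R -> R)) (tau : (R -> R) -> R).
Variables (t h : R -> R) (p : R).
Hypotheses (HG : interval_group G) (HT : normal_translations G A tau t).
Hypothesis derivG : forall f, G f -> exists mu, strict_deriv0 f mu.
Hypotheses (Gh : G h) (p01 : 0 < p < 1) (hp : h p = p).
Hypothesis h1 : 1 < dilation tau t h.
Implicit Types (a f g : R -> R) (x y u v : R).

Let HA := nt_group HT.
Let AG := nt_sub HT.
Let At := nt_mem HT.
Let Psi := affine_chart A tau.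
(** Centred at the fixed point p, the chart turns h into a multiplication. *)
Let phi x := Psi x - Psi p.
Let Gt : G t := AG At.

Let in01 g x : G g -> 0 < x < 1 -> 0 < g x < 1.
Proof. by move=> Gg x01; rewrite (group_gt0 HG)// (group_lt1 HG). Qed.

Let phi_iter n x : 0 < x < 1 ->
  phi (iter n h x) = dilation tau t h ^+ n * phi x.
Proof.
have aff y : 0 < y < 1 -> Psi (h y) = dilation tau t h * Psi y + Psi (h 2^-1).
  exact: (chart_affine HG HT Gh h1 Gh).
move=> x01; elim: n => [|n IH]; first by rewrite mul1r.
rewrite exprS -mulrA -IH iterS /phi aff; last exact: in01 (group_iter HG n Gh) _.
by have := aff _ p01; rewrite hp; lra.
Qed.

Let chart_tr a x : A a -> 0 < x < 1 -> Psi (a x) = tau a + Psi x.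
Proof. exact: (chart_translation HG HT). Qed.

Let reflect x y : 0 < x < 1 -> 0 < y < 1 -> phi x < phi y -> x < y.
Proof.
by move=> x01 y01; rewrite ltrD2r; exact: (chart_reflect HG HT).
Qed.

(* If Psi were constant on [u, v], the 2 ^ n images of [u, v] under the words of
   length n in two contractions f and g with the same derivative mu at 0 would
   have pairwise disjoint interiors and lie in an interval of length about
   mu ^ n, although each has length about mu ^ n. *)
Lemma chart_injective u v : 0 < u < 1 -> 0 < v < 1 -> u < v -> Psi u < Psi v.
Proof.
move=> u01 v01 uv; rewrite lt_neqAle; apply/andP; split; last first.
  by apply: (chart_mono HG HT) => //; exact: ltW.
apply/eqP => Puv.
(* A factor L > 2 is what separates the images under f and g in [order] below. *)
have [r rH] := expr_unbounded 2 h1; set L := _ ^+ r in rH.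
have L0 : 0 < L := lt_trans (ltr0n R 2) rH.
pose f := iter r h; have Gf : G f := group_iter HG r Gh.
have phif n x : 0 < x < 1 -> phi (iter n f x) = L ^+ n * phi x.
  by move=> x01; rewrite -iter_mul phi_iter// mulnC exprM.
pose g := t \o f \o cinv t.
have GV := group_inv HG Gt; have AV := group_inv HA At.
have Gg : G g by apply: (group_comp HG) => //; exact: group_comp.
have tauVt : tau (cinv t) = - tau t by exact: (hom_inv HA (nt_hom HT)).
set d := tau t in tauVt; have d0 : 0 < d by exact: (nt_pos HT At (nt_gt HT)).
have phig n x : 0 < x < 1 -> phi (iter n g x) = L ^+ n * (phi x - d) + d.
  move=> x01; rewrite /g (iter_conj HG)//=.
  have Vx := in01 GV x01.
  rewrite /phi chart_tr ?in01//; last exact: group_iter.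
  rewrite -/d -addrA -[_ (iter n f _) - _]/(phi (iter n f (cinv t x))) phif//.
  by rewrite /phi chart_tr// tauVt addrC; congr (_ * _ + _); ring.
have [mu fmu] := derivG Gf; have gmu := deriv_conj HG derivG Gf Gt fmu.
have mu0 := deriv_gt0 HG derivG Gf fmu.
(* Up to [D], f and g scale lengths by at least 7/8 mu and at most 9/8 mu. Two images together thus
   gain the factor 7/4 mu, and the ratio 14/9 of 7/4 to 9/8 exceeds 1. *)
have e0 : 0 < mu / 8 by rewrite divr_gt0.
have [d1 d10 H1] := fmu _ e0; have [d2 d20 H2] := gmu _ e0.
(* f fixes p and g fixes t p; left of t^-1 p both move points towards 0. *)
pose D := Num.min (Num.min d1 d2) (cinv t p).
have /andP[Vp0 Vp1] := in01 GV p01.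
have D0 : 0 < D by rewrite !lt_min d10 d20.
have Dd1 : D <= d1 by rewrite !ge_min lexx.
have Dd2 : D <= d2 by rewrite !ge_min lexx orbT.
have Dp : D <= cinv t p by rewrite ge_min lexx orbT.
have D01 x : 0 < x -> x <= D -> 0 < x < 1.
  by move=> x0 xD; rewrite x0 (le_lt_trans xD)// (le_lt_trans Dp).
have phiD x : 0 < x -> x <= D -> phi x < 0.
  move=> x0 xD; apply: (@le_lt_trans _ _ (phi (cinv t p))).
    rewrite lerD2r; apply: (chart_mono HG HT) => //; first exact: D01.
      by rewrite Vp0.
    exact: le_trans Dp.
  by rewrite /phi chart_tr// tauVt; lra.
have fD x : 0 < x -> x <= D -> 0 < f x < x.
  move=> x0 xD; have x01 := D01 _ x0 xD; have /andP[fx0 _] := in01 Gf x01.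
  rewrite fx0; apply: reflect => //; first exact: in01.
  by have := phif 1%N x x01; rewrite expr1 /= => ->; have := phiD _ x0 xD; nra.
have gD x : 0 < x -> x <= D -> 0 < g x < x.
  move=> x0 xD; have x01 := D01 _ x0 xD; have /andP[gx0 _] := in01 Gg x01.
  rewrite gx0; apply: reflect => //; first exact: in01.
  by have := phig 1%N x x01; rewrite expr1 /= => ->; have := phiD _ x0 xD; nra.
have fup n x : 0 < x -> x <= D -> 0 < iter n f x <= D /\
    iter n f x <= (mu * (9 / 8)) ^+ n * x.
  move=> x0 xD; elim: n => [|n [/andP[n0 nD] IH]].
    by rewrite x0 xD mul1r.
  have /andP[a b] := fD _ n0 nD.
  rewrite iterS a (le_trans (ltW b))//; split=> //.
  have := H1 0 (iter n f x) (lexx _) (ltW n0) (le_trans nD Dd1).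
  rewrite (group0 HG Gf) !subr0 ler_norml => /andP[_ Hn].
  apply: (@le_trans _ _ (mu * (9 / 8) * iter n f x)); first by lra.
  by rewrite exprS -[leRHS]mulrA ler_pM2l//; lra.
pose c := mu * (7 / 4).
have c0 : 0 < c by rewrite /c; lra.
(* In the chart g lies left of f, so [g^n x, f^n y] is the hull of the images of [x, y] under the
   words of length n. At each step it contains two disjoint hulls of level n, those of f [x, y] and
   g [x, y]. *)
have grow n : forall x y, 0 < x -> x < y -> y <= D -> Psi x = Psi y ->
    c ^+ n * (y - x) <= iter n f y - iter n g x.
  elim: n => [|n IH] x y x0 xy yD Pxy; first by rewrite mul1r.
  have y0 := lt_trans x0 xy; have xD := le_trans (ltW xy) yD.
  have x01 := D01 _ x0 xD; have y01 := D01 _ y0 yD.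
  have /andP[fx0 fxx] := fD _ x0 xD; have /andP[fy0 fyy] := fD _ y0 yD.
  have /andP[gx0 gxx] := gD _ x0 xD; have /andP[gy0 gyy] := gD _ y0 yD.
  have phixy : phi x = phi y by rewrite /phi Pxy.
  have Pf : Psi (f x) = Psi (f y).
    apply: (addIr (- Psi p)); rewrite -/(phi (f x)) -/(phi (f y)).
    by rewrite (phif 1%N x)// (phif 1%N y)// phixy.
  have Pg : Psi (g x) = Psi (g y).
    apply: (addIr (- Psi p)); rewrite -/(phi (g x)) -/(phi (g y)).
    by rewrite (phig 1%N x)// (phig 1%N y)// phixy.
  have F1 := IH (f x) (f y) fx0 _ (le_trans (ltW fyy) yD) Pf.
  have F2 := IH (g x) (g y) gx0 _ (le_trans (ltW gyy) yD) Pg.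
  have {}F1 := F1 (etrans (group_lt HG _ _ Gf) xy).
  have {}F2 := F2 (etrans (group_lt HG _ _ Gg) xy).
  have order : iter n f (g y) < iter n g (f x).
    have gy01 := in01 Gg y01; have fx01 := in01 Gf x01.
    apply: reflect; [exact: in01 (group_iter HG n Gf) _|
      exact: in01 (group_iter HG n Gg) _|].
    rewrite phif// phig// (phig 1%N y)// (phif 1%N x)// !expr1 phixy.
    have Ln : 0 < L ^+ n by rewrite exprn_gt0.
    (* In the chart the gap between the two points is d + L^n d (L - 2). *)
    have : 0 < L ^+ n * d * (L - 2).
      by rewrite mulr_gt0 ?subr_gt0//; exact: mulr_gt0.
    lra.
  have := H1 x y (ltW x0) (ltW xy) (le_trans yD Dd1).
  have := H2 x y (ltW x0) (ltW xy) (le_trans yD Dd2).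
  rewrite !ler_norml -/g => /andP[B2 _] /andP[B1 _].
  rewrite !iterSr.
  have cn : 0 < c ^+ n by rewrite exprn_gt0.
  have : c ^+ n.+1 * (y - x) <= c ^+ n * (f y - f x) + c ^+ n * (g y - g x).
    rewrite exprSr -mulrA -mulrDr ler_pM2l// /c; lra.
  lra.
(* A power of t^-1 brings the collapsed interval into (0, D); translations preserve the equality of
   chart values. *)
have [n0 Hn0] := translation_escapeV HG HT v01
  (D01 _ D0 (lexx _)).
have AVn := group_iter HA n0 AV; have GVn := AG AVn.
have /andP[x0 _] := in01 GVn u01; set x := iter n0 (cinv t) u in x0.
set y := iter n0 (cinv t) v in Hn0.
have xy : x < y by rewrite (group_lt HG).
have y0 := lt_trans x0 xy.
have Pxy : Psi x = Psi y by rewrite /x /y !chart_tr// Puv.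
(* For this n the lower bound (7/4 mu)^n (y - x) exceeds the upper bound (9/8 mu)^n y on f^n y. *)
have [n Hn] := @expr_unbounded R (14 / 9) (y / (y - x)) ltac:(lra).
have := grow n x y x0 xy (ltW Hn0) Pxy; have [_ up] := fup n y y0 (ltW Hn0).
have x01 := D01 _ x0 (le_trans (ltW xy) (ltW Hn0)).
have /andP[gn0 _] := in01 (group_iter HG n Gg) x01.
move: Hn; rewrite ltr_pdivrMr ?subr_gt0// => Hn.
have -> : c = 14 / 9 * (mu * (9 / 8)) by rewrite /c; field.
rewrite exprMn mulrAC.
have q0 : 0 < (mu * (9 / 8)) ^+ n by rewrite exprn_gt0//; lra.
set q := _ ^+ n in q0 up *; set w := _ * (y - x) in Hn *.
have : q * y < w * q by rewrite mulrC ltr_pM2r.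
lra.
Qed.

End Injectivity.

(** * One-sided derivatives at 0 *)

(** An increasing map onto R has no jumps. This gives continuity on R without gluing [0, 1] to its
    complement. *)
Lemma increasing_cancel_continuous (R : realType) (f g : R -> R) :
  {homo f : x y / x < y} -> cancel g f -> continuous f.
Proof.
move=> fmono gK x; apply/cvgrPdist_lt => e e0.
have mono : {mono f : x y / x < y} := leW_mono (le_mono fmono).
have y1 : g (f x - e) < x by rewrite -mono gK gtrBl.
have y2 : x < g (f x + e) by rewrite -mono gK ltrDl.
near=> z.
have z1 : g (f x - e) < z by near: z; exact: lt_nbhsr.
have z2 : z < g (f x + e) by near: z; exact: lt_nbhsl.
rewrite -(mono (g _)) gK in z1; rewrite -(mono z) gK in z2.
by rewrite ltr_norml; lra.
Unshelve. all: by end_near. Qed.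

(** At an interior point the restriction to [0, 1] disappears once the increment is smaller than the
    distance to both endpoints. *)
Lemma quotient_is_derive (R : realType) (f : R -> R) (c l : R) : 0 < c < 1 ->
  (f y - f c) / (y - c) @[y --> within `[0, 1] c^'] --> l -> is_derive c 1 f l.
Proof.
move=> /andP[c0 c1] /cvgrPdist_le Hq.
suff H : h^-1 *: ((f \o shift c) (h *: (1 : R)) - f c) @[h --> 0^'] --> l.
  by apply: DeriveDef; [apply/cvg_ex; exists l|exact: cvg_lim].
apply/cvgrPdist_le => e /Hq; rewrite !near_withinE => /nbhs_ballP[d /= d0 Hd].
have m0 : 0 < Num.min d (Num.min c (1 - c)) by rewrite !lt_min d0 c0 subr_gt0.
near=> h => /= h0.
have : `|h| < Num.min d (Num.min c (1 - c)).
  by near: h; apply: (@nbhs0_lt _ R).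
rewrite !lt_min => /and3P[hd hc hc1].
have := Hd (h + c); rewrite /ball/= opprD addrCA subrr addr0 normrN => /(_ hd).
have hc' : h + c != c by rewrite -subr_eq0 addrK.
have h01 : `[0, 1]%classic (h + c).
  rewrite /= in_itv/=; move: hc hc1; rewrite !ltr_norml; lra.
move=> /(_ hc' h01); rewrite addrK => /=.
have -> : h *: (1 : R) = h by exact: mulr1.
by rewrite [h^-1 *: _]mulrC.
Unshelve. all: by end_near. Qed.

(** By the mean value theorem the quotient over [x, y] is a value of [df] between x and y, hence
    close to [df 0]. *)
Lemma C1_unit_strict_deriv0 (R : realType) (f : R -> R) : continuous f ->
  C1_unit f -> exists mu, strict_deriv0 f mu.
Proof.
move=> cf [df [cdf Hdf]]; exists (df 0) => e e0.
have [_ /cvgrPdist_le/(_ e e0)] := (continuous_within_itvP df (@ltr01 R)).1 cdf.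
rewrite near_withinE => /nbhs_ballP[d /= d0 Hd] _.
exists (Num.min (d / 2) 1); first by rewrite lt_min ltr01 divr_gt0.
move=> x y x0 xy; rewrite le_min => /andP[yd y1].
have [->|xy'] := eqVneq x y; first by rewrite !subrr mulr0 subr0 normr0 mulr0.
have {xy xy'} xy : x < y by rewrite lt_neqAle xy'.
have [|c +] := @MVT R f df x y xy _ (continuous_subspaceT cf).
  move=> c; rewrite in_itv/= => /andP[xc cy]; apply: quotient_is_derive.
    by rewrite (le_lt_trans x0)// (lt_le_trans cy).
  apply: Hdf; rewrite /= in_itv/=; lra.
rewrite in_itv/= => /andP[xc cy] ->; rewrite -mulrBl normrM.
have c0 : 0 < c := le_lt_trans x0 xc.
rewrite [X in _ * X]gtr0_norm ?subr_gt0// ler_pM2r ?subr_gt0//.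
rewrite distrC; apply: Hd => //=; rewrite /ball/= sub0r normrN gtr0_norm//.
by rewrite (lt_trans cy)// (le_lt_trans yd)//; lra.
Qed.

(** * Groups of diffeomorphisms of the interval *)

Lemma Diff_plus_increasing (R : realType) (f : R -> R) :
  Diff_plus f -> {homo f : x y / x < y}.
Proof.
case=> fout [g [[[f01 _] _ _ finc] _ _]].
have in01 (x : R) : (`[0, 1]%classic x) = (0 <= x <= 1) :> Prop.
  by rewrite /= in_itv.
have range (x : R) : 0 <= x <= 1 -> 0 <= f x <= 1.
  by move=> H; have := f01 x; rewrite !in01; apply.
have out (x : R) : ~~ (0 <= x <= 1) -> f x = x.
  by move=> H; apply: fout; rewrite in01; exact/negP.
move=> x y xy; have [x01|/[dup] x01 /out ->] := boolP (0 <= x <= 1);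
  have [y01|/[dup] y01 /out ->] := boolP (0 <= y <= 1) => //.
- by apply: finc; rewrite ?in01.
- by have := range x x01; move: y01; rewrite negb_and -!ltNge; lra.
- by have := range y y01; move: x01; rewrite negb_and -!ltNge; lra.
Qed.

Lemma Diff_plus_out (R : realType) (f : R -> R) (x : R) :
  Diff_plus f -> ~ (0 < x < 1) -> f x = x.
Proof.
move=> Df; have finc := Diff_plus_increasing Df.
have fle := le_mono finc.
case: Df => fout [g [[[f01 g01] [_ gK] _ _] _ _]] x01.
have I01 (z : R) : (0 <= z <= 1) -> `[0, 1]%classic z by rewrite /= in_itv.
have J01 (z : R) : `[0, 1]%classic z -> (0 <= z <= 1) by rewrite /= in_itv.
have [xI|/negP xI] := boolP (0 <= x <= 1); last first.
  by apply: fout => /J01.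
have E : x = 0 \/ x = 1.
  have [->|h0] := eqVneq x 0; [by left|right].
  have [//|h1] := eqVneq x 1; exfalso; apply: x01.
  by rewrite !lt_neqAle eq_sym h0 h1.
have [fx0 fx1] := andP (J01 _ (f01 _ (I01 _ xI))).
have [gx0 gx1] := andP (J01 _ (g01 _ (I01 _ xI))).
apply/le_anti; case: E => E; subst x; rewrite ?fx0 ?fx1 ?andbT /=.
- by rewrite -{2}(gK _ (I01 _ xI)) fle.
- by rewrite -{1}(gK _ (I01 _ xI)) fle.
Qed.

Lemma finite_fixed_points_interval_group (R : realType) (G : set (R -> R)) :
  transf_subgroup G (@Diff_plus R) ->
  (forall f, G f -> f <> id -> finite_set (fixed_points f)) -> interval_group G.
Proof.
move=> [TG GD] Gfin; have inc f : G f -> {homo f : x y / x < y}.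
  by move=> /GD; exact: Diff_plus_increasing.
split=> //.
- move=> f Gf; have [_ _ /(_ f Gf)[g [_ _ gK]]] := TG.
  exact: increasing_cancel_continuous (inc _ Gf) gK.
- by move=> f /GD Df x; exact: Diff_plus_out.
(* A finite set is closed, and 0 is not in it; so some neighbourhood of 0 contains no fixed point of
   (0, 1). *)
move=> f Gf fid; have /closed_openC : closed (fixed_points f).
  apply: (accessible_finite_set_closed.1 _ _ (Gfin _ Gf fid)).
  exact: hausdorff_accessible (@Rhausdorff R).
rewrite openE => /(_ 0); case.
  by move=> [] /=; rewrite in_itv/= ltxx.
move=> d /= d0 dH; rewrite near_withinE; apply/nbhs_ballP.
exists (Num.min d 1); first by rewrite /= lt_min d0 ltr01.
move=> x; rewrite /ball/= sub0r normrN lt_min => /andP[xd x1] x0 fx.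
apply: (dH x); first by rewrite /ball/= sub0r normrN.
by split=> //; rewrite /= in_itv/= x0; move: x1; rewrite gtr0_norm.
Qed.

Lemma fixed_points_lt_card (R : realType) (N : nat) (f : R -> R) (c : nat -> R) :
  (fixed_points f #<= `I_N)%card ->
  (forall i, (i <= N)%N -> 0 < c i < 1 /\ f (c i) = c i) ->
  (forall i, (i < N)%N -> c i < c i.+1) -> False.
Proof.
move=> fN cfix cinc.
have mono i j : (i < j)%N -> (j <= N)%N -> c i < c j.
  elim: j => // j IH; rewrite ltnS leq_eqVlt => /predU1P[->|ij] jN.
    exact: cinc.
  exact: lt_trans (IH ij (ltnW jN)) (cinc _ jN).
have cinj : {in `I_N.+1 &, injective c}.
  move=> i j; rewrite !inE/= !ltnS => iN jN cij.
  by have [/mono/(_ jN)|/mono/(_ iN)|//] := ltngtP i j; rewrite cij ltxx.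
have : (`I_N.+1 #<= `I_N)%card.
  apply: card_le_trans fN; rewrite -(card_le_eql (inj_card_eq cinj)).
  apply: subset_card_le => _ [i /= iN <-]; split; last exact: (cfix i iN).2.
  by rewrite /= in_itv/=; exact: (cfix i iN).1.
by rewrite card_le_II ltnn.
Qed.

Lemma transf_subgroup_image (R : realType) (G H : set (R -> R))
    (phi : (R -> R) -> (R -> R)) :
  transf_group G -> phi id = id ->
  (forall f g, G f -> G g -> phi (f \o g) = phi f \o phi g) ->
  (forall f g, G f -> G g -> phi f = phi g -> f = g) ->
  (forall f, G f -> H (phi f)) ->
  transf_subgroup (phi @` G) H /\ transf_isom G (phi @` G).
Proof.
move=> [Gid Gcomp Ginv] phi1 phiM phiI phiH; split; last first.
  exists phi; split=> //; split=> //.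
  by move=> f g /set_mem Gf /set_mem Gg; exact: phiI.
split; last by move=> _ [f Gf <-]; exact: phiH.
split; first by exists id.
- by move=> _ _ [f Gf <-] [g Gg <-]; exists (f \o g); [exact: Gcomp|exact: phiM].
- move=> _ [f Gf <-]; have [g [Gg fK gK]] := Ginv f Gf.
  have cancel_phi u v : G u -> G v -> cancel u v -> cancel (phi u) (phi v).
    move=> Gu Gv uK x; rewrite -[LHS]/((phi v \o phi u) x) -phiM//.
    by rewrite (_ : v \o u = id) ?phi1//; apply/funext => y; exact: uK.
  by exists (phi g); split; [exists g|exact: cancel_phi|exact: cancel_phi].
Qed.

Lemma exists_normal_translations (R : realType) (N : nat) (G : set (R -> R))
    (h : R -> R) :
  interval_group G ->
  (forall f, G f -> f <> id -> forall c : nat -> R,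
    (forall i, (i <= N)%N -> 0 < c i < 1 /\ f (c i) = c i) ->
    (forall i, (i < N)%N -> c i < c i.+1) -> False) ->
  (forall x : R, 0 < x < 1 -> exists2 g, G g & g x <> x) ->
  G h -> h <> id -> exists A tau t, normal_translations G A tau t.
Proof.
move=> HG fixN irr Gh hid.
have [f Gf f1] : exists2 f, G f & germ_lt id f.
  case: (germ_total1 HG Gh hid) => [h1|h1]; first by exists h.
  by exists (cinv h); [exact: group_inv|exact: (germ_ltN' HG)].
have [t mint] := exists_germ_minimal HG fixN Gf f1.
have HA := minimal_class_interval HG mint.
have [tau [tauD tau_gt0]] := hoelder HA (minimal_class_archimedean HG mint).
have [_ t1 _] := mint.
have AG : minimal_class G t `<=` G by move=> ? [].
exists (minimal_class G t), tau, t; split=> //.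
- by move=> g a; exact: minimal_class_normal.
- apply: (normal_free HG HA AG _ _ irr).
    by move=> g a; exact: minimal_class_normal.
  by move=> a b; exact: (hom_comm HA tauD tau_gt0).
- exact: minimal_class_mem.
Qed.

Lemma affine_conjugation (R : realType) (N : nat) (G : set (R -> R)) :
  interval_group G ->
  (forall f, G f -> exists mu, strict_deriv0 f mu) ->
  (forall f, G f -> f <> id -> forall c : nat -> R,
    (forall i, (i <= N)%N -> 0 < c i < 1 /\ f (c i) = c i) ->
    (forall i, (i < N)%N -> c i < c i.+1) -> False) ->
  (forall x : R, 0 < x < 1 -> exists2 g, G g & g x <> x) ->
  ~ free_action G ->
  exists Psi Psi' : R -> R,
  [/\ forall x : R, 0 < x < 1 -> Psi' (Psi x) = x,
      forall y : R, 0 < Psi' y < 1 /\ Psi (Psi' y) = y,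
      forall x y : R, 0 < x < 1 -> 0 < y < 1 -> x < y -> Psi x < Psi y &
      forall g, G g -> exists a b : R, 0 < a /\
        forall x : R, 0 < x < 1 -> Psi (g x) = a * Psi x + b].
Proof.
move=> HG derivG fixN irr nfree.
have [k [p [Gk kid p01 kp]]] : exists k p, [/\ G k, k <> id, 0 < p < 1 & k p = p].
  apply: contrapT => no; apply: nfree => f Gf fid x x01 fx; apply: no.
  by exists f, x.
have [A [tau [t HT]]] := exists_normal_translations HG fixN irr Gk kid.
have [h [Gh hp h1]] := expanding_element HG HT Gk kid p01 kp.
pose Psi := affine_chart A tau.
have inc x y : 0 < x < 1 -> 0 < y < 1 -> x < y -> Psi x < Psi y.
  exact: (chart_injective HG HT derivG Gh p01 hp h1).
have /choice[Psi' HPsi'] : forall y, exists x : R, 0 < x < 1 /\ Psi x = y.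
  by move=> y; have [x ? ?] := chart_surj HG HT Gh h1 y; exists x.
exists Psi, Psi'; split=> //.
- move=> x x01; have [y01 yE] := HPsi' (Psi x).
  have [H|H|//] := ltgtP (Psi' (Psi x)) x.
  + by have := inc _ _ y01 x01 H; rewrite yE ltxx.
  + by have := inc _ _ x01 y01 H; rewrite yE ltxx.
- move=> g Gg; exists (dilation tau t g), (Psi (g 2^-1)); split.
    exact: (dilation_gt0 HG HT).
  by move=> x; exact: (chart_affine HG HT Gh h1 Gg).
Qed.

Lemma ohomeo_lt_inv (R : realType) (A B : set R) (f g : R -> R) x y :
  ohomeo A B f g -> B x -> B y -> x < y -> g x < g y.
Proof.
move=> [[_ gA] [_ gK] _ finc] Bx By; have := finc _ _ (gA _ By) (gA _ Bx).
rewrite !gK// => H; apply: contraTT; rewrite -!leNgt le_eqVlt.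
by move=> /predU1P[E|/H/ltW//]; rewrite -(gK _ Bx) -(gK _ By) E.
Qed.

Theorem theorem1p1 (R : realType) (N : nat) (Gamma : set (R -> R)) :
  transf_subgroup Gamma (@Diff_plus R) ->
  irreducible Gamma ->
  (forall f, Gamma f -> f <> id -> (fixed_points f #<= `I_N)%card) ->
  (exists Delta : set (R -> R),
     transf_subgroup Delta (@Aff_plus R) /\ transf_isom Gamma Delta) /\
  (~ transf_abelian Gamma ->
   forall theta theta' : R -> R, identification theta theta' ->
   exists Delta : set (R -> R),
     transf_subgroup Delta (@Aff_plus R) /\
     conjugate (conj_set theta theta' Gamma) Delta).
Proof.
move=> TG irr cardN; have [TGa GD] := TG.
have HG : interval_group Gamma.
  apply: finite_fixed_points_interval_group => // f Gf fid.
  by apply/finite_set_leP; exists N; exact: cardN.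
have [free|nfree] := EM (free_action Gamma).
  have [tau [tauD tau_gt0]] := hoelder HG (free_archimedean HG free).
  split; last first.
    (* An injective homomorphism into the reals makes a free group abelian. *)
    by case=> f g Gf Gg; exact: (hom_comm HG tauD tau_gt0).
  exists ((fun f x => x + tau f) @` Gamma).
  apply: transf_subgroup_image => //.
  - by apply/funext => x; rewrite (hom_id HG tauD) addr0.
  - by move=> f g Gf Gg; apply/funext => x /=; rewrite tauD//; ring.
  - move=> f g Gf Gg /(congr1 (fun k => k 0)); rewrite !add0r.
    exact: (hom_inj HG tauD tau_gt0).
  - move=> f Gf; exists 1, (tau f); split=> //.
    by apply/funext => x; rewrite mul1r.
have irr' (x : R) : 0 < x < 1 -> exists2 g, Gamma g & g x <> x.
  move=> x01; apply: contrapT => no; apply: irr; exists x.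
  split; first by rewrite /= in_itv/=.
  by move=> f Gf; apply: contrapT => fx; apply: no; exists f.
have [Psi [Psi' [PsiK Psi'K Psi_inc Psi_aff]]] : exists Psi Psi' : R -> R,
  [/\ forall x : R, 0 < x < 1 -> Psi' (Psi x) = x,
      forall y : R, 0 < Psi' y < 1 /\ Psi (Psi' y) = y,
      forall x y : R, 0 < x < 1 -> 0 < y < 1 -> x < y -> Psi x < Psi y &
      forall g, Gamma g -> exists a b : R, 0 < a /\
        forall x : R, 0 < x < 1 -> Psi (g x) = a * Psi x + b].
  apply: (affine_conjugation (N := N)) => //.
  - move=> f Gf; apply: C1_unit_strict_deriv0; first exact: (group_cont HG).
    by have [_ [g [_ + _]]] := GD _ Gf.
  - by move=> f Gf fid c; exact: fixed_points_lt_card (cardN _ Gf fid).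
have in01 g (x : R) : Gamma g -> 0 < x < 1 -> 0 < g x < 1.
  by move=> Gg x01; rewrite (group_gt0 HG)// (group_lt1 HG).
have [HD Hiso] : transf_subgroup ((fun f => Psi \o f \o Psi') @` Gamma)
    (@Aff_plus R) /\ transf_isom Gamma ((fun f => Psi \o f \o Psi') @` Gamma).
  apply: transf_subgroup_image => //.
  - by apply/funext => y /=; exact: (Psi'K y).2.
  - move=> f g Gf Gg; apply/funext => y /=; rewrite PsiK//.
    exact: in01 Gg (Psi'K y).1.
  - move=> f g Gf Gg E; apply/funext => x.
    have [x01|/negP x01] := boolP (0 < x < 1); last first.
      by rewrite !(group_out HG).
    have /= := congr1 (fun k => Psi' (k (Psi x))) E.
    by rewrite !PsiK//; exact: in01.
  - move=> g Gg; have [a [b [a0 ab]]] := Psi_aff g Gg.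
    exists a, b; split=> //; apply/funext => y /=.
    by have [y01 yE] := Psi'K y; rewrite ab// yE.
split; first by exists ((fun f => Psi \o f \o Psi') @` Gamma).
move=> _ theta theta' Hth.
(* Every identification theta leads to the same affine group, with conjugator Psi theta^-1. *)
exists ((fun f => Psi \o f \o Psi') @` Gamma); split=> //.
have [[_ th'01] [thK th'K] _ _] := Hth.
have {}th'01 y : 0 < theta' y < 1.
  by have := th'01 y I; rewrite /= in_itv.
have {}thK (x : R) : 0 < x < 1 -> theta' (theta x) = x.
  by move=> x01; apply: thK; rewrite /= in_itv.
have psi_inc (x y : R) : x < y -> Psi (theta' x) < Psi (theta' y).
  by move=> xy; apply: Psi_inc => //; exact: (ohomeo_lt_inv Hth).
have psiK : cancel (Psi \o theta') (theta \o Psi').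
  by move=> x /=; rewrite PsiK// th'K.
have psi'K : cancel (theta \o Psi') (Psi \o theta').
  by move=> y /=; have [y01 yE] := Psi'K y; rewrite thK.
exists (Psi \o theta'), (theta \o Psi'); split.
  have Ho : {homo Psi \o theta' : x y / x < y} by move=> x y /=; exact: psi_inc.
  split; [by []|by split=> x _; [exact: psiK|exact: psi'K]| |
    by move=> x y _ _; exact: Ho].
  split; apply: continuous_subspaceT.
    exact: increasing_cancel_continuous Ho psi'K.
  apply: increasing_cancel_continuous psiK => x y xy.
  by rewrite -(leW_mono (le_mono Ho)) !psi'K.
rewrite /conj_set image_comp; apply: eq_imagel => f Gf; apply/funext => y /=.
by have [y01 yE] := Psi'K y; rewrite (thK _ y01) thK//; exact: in01.
Qed.
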